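(* Let $k$ be a field, let $P_1,\dots,P_n$ be a family of distinct rational points in a projective space $\mathbf{P}^N_k$ and let $m\ge 2$ be an integer. Then the smallest number of $m$-linked points in $\{P_1,\dots,P_n\}$ is (i) $m+2$ if and only if $m+2$ of the $P_i$'s are collinear; (ii) $2m+2$ if and only if no $m+2$ of the $P_i$'s are collinear and $2m+2$ of the $P_i$'s lie on a plane conic; (iii) $3m$ if and only if no $m+2$ of the $P_i$'s are collinear, no $2m+2$ of them lie on a plane conic and $3m$ of them lie at the intersection of two coplanar plane curves of respective degrees $3$ and $m$ having no common irreducible component; (iv) $>3m$ if and only if no $m+2$ of the $P_i$'s are collinear, no $2m+2$ of them lie on a plane conic and no $3m$ of them lie at the intersection of two coplanar plane curves of respective degrees $3$ and $m$ having no common irreducible component.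
   Context: Let $\mathcal{F}_{m,N}$ be the $k$-vector space of homogeneous forms of degree $m$ in $N+1$ variables over $k$. For a rational point $P=(p_0:\cdots:p_N)$ of $\mathbf{P}^N$, with $i$ the smallest index such that $p_i\ne0$, put $\mathrm{ev}_P:\mathcal{F}_{m,N}\to k$, $f\mapsto f(p_0,\dots,p_N)/p_i^m$. A family of rational points is in $m$-general position if the corresponding evaluation maps are linearly independent in the dual space $\mathcal{F}_{m,N}^{\vee}$; it is $m$-linked if it is not in $m$-general position. The smallest number of $m$-linked points in a set is the smallest cardinality of an $m$-linked subset (taken to be $+\infty$ if there is none). Conics may be reducible; plane curves are considered over the algebraic closure of $k$.
   Formalization: In (iii), ''the smallest number is 3m'' is read as ''is 3m and 3m ≠ 2m+2'': for m = 2 the values in (ii) and (iii) coincide and (iii) as written fails, e.g. for six points on a smooth conic; for m ≥ 3 nothing changes. *)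

(* Defs.v *)
From HB Require Import structures.
From mathcomp Require Import all_boot all_order all_algebra.
From mathcomp Require Import mpoly.

Set Implicit Arguments.
Unset Strict Implicit.
Unset Printing Implicit Defensive.

Import GRing.Theory.
Local Open Scope ring_scope.

(* A point of P^N(F) is given by a nonzero row vector of homogeneous
   coordinates; two nonzero vectors give the same point exactly when they span
   the same line of F^(N+1), i.e. have the same row space. *)
Definition distinct_points (F : fieldType) (N n : nat)
    (P : 'I_n -> 'rV[F]_N.+1) : Prop :=
  (forall i, P i != 0) /\ (forall i j, (P i == P j)%MS -> i = j).

Section Evaluation.

Variables (F : fieldType) (N m : nat).

(* The default ord0 is only reached for p = 0. *)
Definition lead_index (p : 'rV[F]_N.+1) : 'I_N.+1 :=
  odflt ord0
    [pick i | (p 0 i != 0) && [forall j : 'I_N.+1, (j < i)%N ==> (p 0 j == 0)]].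

Definition eval_at (p : 'rV[F]_N.+1) (f : dhomog N.+1 F m) : F^o :=
  (mpoly_of_dhomog f).@[fun i => p 0 i] / p 0 (lead_index p) ^+ m.

Fact eval_at_is_linear p : linear (eval_at p).
Proof.
move=> a f g; rewrite /eval_at mpoly_of_dhomog_is_linear mevalD mevalZ.
by rewrite mulrDl -mulrA.
Qed.

HB.instance Definition _ p :=
  GRing.isLinear.Build F (dhomog N.+1 F m) F^o _ (eval_at p)
    (eval_at_is_linear p).

Definition ev (p : 'rV[F]_N.+1) : 'Hom(dhomog N.+1 F m, F^o) :=
  linfun (eval_at p).

End Evaluation.

Section Linked.

Variables (F : fieldType) (N n m : nat) (P : 'I_n -> 'rV[F]_N.+1).

Definition general_position (S : {set 'I_n}) : bool :=
  free [seq ev m (P i) | i <- enum S].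

Definition linked (S : {set 'I_n}) : bool := ~~ general_position S.

(* None stands for +oo. *)
Definition min_linked : option nat :=
  if [pick S | linked S] is Some S0
  then Some #|[arg min_(S < S0 | linked S) #|S|]| else None.

End Linked.

(* The order s < x, for s finite and x in {0, 1, ...} with +oo added. *)
Definition lt_inf (s : nat) (x : option nat) : bool :=
  if x is Some t then (s < t)%N else true.

(* A line of P^N is the row space of a 2 x (N+1) matrix of rank 2. *)
Definition collinear (F : fieldType) (N n : nat) (P : 'I_n -> 'rV[F]_N.+1)
    (S : {set 'I_n}) : Prop :=
  exists2 L : 'M[F]_(2, N.+1), row_free L & forall i, i \in S -> (P i <= L)%MS.

Definition algebraic_closure (k : fieldType) (K : closedFieldType)
    (iota : {rmorphism k -> K}) : Prop :=
  forall x : K, algebraicOver iota x.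

(* A plane of P^N is the row space of a 3 x (N+1) matrix A of rank 3, whose
   rows provide homogeneous coordinates u on it. A curve of degree d in this
   plane is given by a nonzero form of degree d in u, so reducible and
   nonreduced curves are allowed. *)
Definition plane_form (F : fieldType) (d : nat) (f : {mpoly F[3]}) : Prop :=
  f != 0 /\ f \is d.-homog.

Definition on_plane_curve (F : fieldType) (N : nat) (A : 'M[F]_(3, N.+1))
    (f : {mpoly F[3]}) (x : 'rV[F]_N.+1) : Prop :=
  exists2 u : 'rV[F]_3, x = u *m A & f.@[fun j => u 0 j] = 0.

Definition irreducible_mpoly (F : fieldType) (h : {mpoly F[3]}) : Prop :=
  [/\ h != 0, h \isn't a GRing.unit &
      forall a b, h = a * b -> a \is a GRing.unit \/ b \is a GRing.unit].

(* The irreducible components of the curve f = 0 are the curves h = 0 with h an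
   irreducible factor of f (a factor of a form is again a form). *)
Definition common_component (F : fieldType) (f g : {mpoly F[3]}) : Prop :=
  exists h, [/\ irreducible_mpoly h, exists q, f = q * h & exists q, g = q * h].

Section PlaneCurves.

Variables (k : fieldType) (K : closedFieldType) (iota : {rmorphism k -> K}).
Variables (N n : nat) (P : 'I_n -> 'rV[k]_N.+1).

Definition on_conic (S : {set 'I_n}) : Prop :=
  exists (A : 'M[K]_(3, N.+1)) (f : {mpoly K[3]}),
    [/\ row_free A, plane_form 2 f &
        forall i, i \in S -> on_plane_curve A f (map_mx iota (P i))].

Definition on_curve_intersection (d e : nat) (S : {set 'I_n}) : Prop :=
  exists (A : 'M[K]_(3, N.+1)) (f g : {mpoly K[3]}),
    [/\ row_free A, plane_form d f, plane_form e g, ~ common_component f g &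
        forall i, i \in S ->
          on_plane_curve A f (map_mx iota (P i)) /\
          on_plane_curve A g (map_mx iota (P i))].

End PlaneCurves.

Definition some_subset (n s : nat) (Q : {set 'I_n} -> Prop) : Prop :=
  exists2 S : {set 'I_n}, #|S| = s & Q S.

(* Main.v *)
Require Import Defs.
From Stdlib Require Import Classical.
From HB Require Import structures.
From mathcomp Require Import all_boot all_order all_algebra.
From mathcomp Require Import mpoly zify ring.

(* A linked set carries a nontrivial relation sum_i c_i f(P_i) = 0, valid for
   all forms f of degree m.  Multiplying c by the values of a form h of degree
   d gives a relation in degree m - d on the points off h = 0.  Residuating in
   this way by hyperplanes shows that a relation in degree m involves at least
   m + 2 points, that its points are collinear if there are at most 2m + 1 of
   them, and that they are coplanar if there are at most 3m of them and no
   m + 2 are collinear.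

   It remains to treat a minimal linked set S of s <= 3m points in a plane.
   Let h(d) be the number of conditions S imposes on forms of degree d.  The
   relation makes the image of degree d orthogonal to that of degree m - d, so
   h(d) + h(m - d) <= s, while h(m) >= s - 1 by minimality.  If S lies on a
   curve of degree al, then h is concave from al - 1 on.  If S contains neither
   m + 2 collinear points nor 2m + 2 points of a conic, then h(1) = 3 and
   h(2) = 6, which forces increments at least 3 up to degree m - 1; hence
   s = 3m and S lies on a cubic f.  A dimension count gives a form g of degree
   m through S which is not a multiple of f, and Bezout-type counts exclude a
   common component.  The converse directions are dimension counts. *)

Set Implicit Arguments.
Unset Strict Implicit.
Unset Printing Implicit Defensive.

Import GRing.Theory VectorInternalTheory.
Local Open Scope ring_scope.

(** * Relations between values of forms *)

Section Forms.

Variables (F : fieldType) (b : nat).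
Implicit Types (f g : {mpoly F[b]}) (x : 'rV[F]_b) (a : 'cV[F]_b).

Definition evalv x f : F := f.@[fun j => x 0 j].

Lemma evalvD x f g : evalv x (f + g) = evalv x f + evalv x g.
Proof. exact: mevalD. Qed.

Lemma evalvM x f g : evalv x (f * g) = evalv x f * evalv x g.
Proof. exact: mevalM. Qed.

Lemma evalvZ x e f : evalv x (e *: f) = e * evalv x f.
Proof. exact: mevalZ. Qed.

Lemma evalv_sum (I : Type) (r : seq I) (Q : pred I) x (G : I -> {mpoly F[b]}) :
  evalv x (\sum_(i <- r | Q i) G i) = \sum_(i <- r | Q i) evalv x (G i).
Proof. exact: raddf_sum. Qed.

Lemma evalvXn x f e : evalv x (f ^+ e) = evalv x f ^+ e.
Proof. exact: rmorphXn. Qed.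

Definition linform a : {mpoly F[b]} := \sum_j a j 0 *: 'X_j.

Lemma linform_homog a : linform a \is 1.-homog.
Proof. by apply: rpred_sum => j _; apply: rpredZ; rewrite dhomogX /= mdeg1. Qed.

Lemma evalv_linform x a : evalv x (linform a) = (x *m a) 0 0.
Proof.
rewrite /linform evalv_sum mxE; apply: eq_bigr => j _.
by rewrite evalvZ /evalv mevalXU mulrC.
Qed.

Lemma dhomogXn d f e : f \is d.-homog -> f ^+ e \is (e * d).-homog.
Proof. by rewrite mulnC; apply: dhomogMn. Qed.

Lemma evalv_scale d f x (s : F) : f \is d.-homog ->
  evalv (s *: x) f = s ^+ d * evalv x f.
Proof.
move=> /dhomogP hf; rewrite /evalv !mevalE mulr_sumr !big_seq.
apply: eq_bigr => mo mo_f; rewrite mulrCA; congr (_ * _).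
under eq_bigr => j _ do rewrite mxE exprMn.
have <- : mdeg mo = d := hf _ mo_f.
by rewrite big_split /= mdegE -prodrXr.
Qed.

End Forms.

(** Replacing the variable [j] by the linear form whose coefficients are column [j] of [M] preserves
    homogeneity and degree. *)
Lemma form_pullback (F : fieldType) (a b d : nat) (M : 'M[F]_(a, b))
    (f : {mpoly F[b]}) : f \is d.-homog ->
  exists2 g : {mpoly F[a]}, g \is d.-homog &
    forall u, evalv u g = evalv (u *m M) f.
Proof.
move=> hf; pose lq := [tuple linform (col j M) | j < b].
exists (f \mPo lq); last first.
  move=> u; rewrite /evalv comp_mpoly_meval; apply: meval_eq => j.
  by rewrite tnth_mktuple -[LHS]/(evalv _ _) evalv_linform colE mulmxA -colE
    mxE.
rewrite comp_mpolyEX big_seq; apply: rpred_sum => mo mo_f; apply: rpredZ.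
have <- : mdeg mo = d := dhomogP _ _ _ hf mo mo_f.
rewrite comp_mpolyX mdegE.
elim/big_rec2: _ => [|j e q _ hq]; first exact: dhomog1.
apply: dhomogM => //; rewrite tnth_mktuple -[e in e.-homog]muln1.
exact/dhomogXn/linform_homog.
Qed.

(** The columns of [cokermx A] are the coefficients of linear forms cutting out the row space of
    [A], so one of these forms is nonzero at [x]. *)
Lemma linform_separate (F : fieldType) (r b : nat) (A : 'M[F]_(r, b))
    (x : 'rV[F]_b) : ~~ (x <= A)%MS ->
  exists2 a : 'cV[F]_b, A *m a = 0 & (x *m a) 0 0 != 0.
Proof.
rewrite submxE => /matrix0Pn [i [j nz]].
exists (col j (cokermx A)); first by rewrite colE mulmxA mulmx_coker mul0mx.
by rewrite colE mulmxA -colE mxE -(ord1 i).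
Qed.

Lemma sub_linform0 (F : fieldType) (r b : nat) (A : 'M[F]_(r, b))
    (x : 'rV[F]_b) (a : 'cV[F]_b) : A *m a = 0 -> (x <= A)%MS -> x *m a = 0.
Proof. by move=> Aa /submxP[D ->]; rewrite -mulmxA Aa mulmx0. Qed.

Section Dependence.

Variables (F : fieldType) (b n : nat) (p : 'I_n -> 'rV[F]_b).
Implicit Types (c : 'I_n -> F) (d : nat).

(** Unlike in [ev], the values are not normalized: at nonzero points the normalizing factors can be
    absorbed into [c]. *)
Definition dep d c : Prop :=
  forall f, f \is d.-homog -> \sum_i c i * evalv (p i) f = 0.

Definition supp c : {set 'I_n} := [set i | c i != 0].

Lemma dep_mul d e c h : h \is e.-homog -> dep (d + e) c ->
  dep d (fun i => c i * evalv (p i) h).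
Proof.
move=> hh dc f hf; have := dc _ (dhomogM hf hh).
by move=> eq0; rewrite -[RHS]eq0; apply: eq_bigr => i _; rewrite evalvM; ring.
Qed.

Lemma supp_mul c h :
  supp (fun i => c i * evalv (p i) h) =
  supp c :\: [set i | evalv (p i) h == 0].
Proof. by apply/setP=> i; rewrite !inE mulf_eq0 negb_or andbC. Qed.

(* c' is c multiplied by the values of a linear form vanishing on A. *)
Lemma dep_residual d c (r : nat) (A : 'M[F]_(r, b)) : dep d.+1 c ->
  (forall i, i \in supp c -> (p i <= A)%MS) \/
  exists c', [/\ dep d c', (0 < #|supp c'|)%N &
    forall Y : {set 'I_n}, Y \subset supp c ->
      (forall i, i \in Y -> (p i <= A)%MS) -> supp c' \subset supp c :\: Y].
Proof.
move=> dc; have [/forall_inP|] := boolP [forall i in supp c, (p i <= A)%MS].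
  by left.
case/forall_inPn => i0 i0c /linform_separate[a Aa nz]; right.
exists (fun i => c i * evalv (p i) (linform a)); rewrite supp_mul.
split; first by apply: (dep_mul (e := 1)); rewrite ?addn1 // linform_homog.
- by apply/card_gt0P; exists i0; rewrite in_setD i0c inE evalv_linform nz.
- move=> Y Yc YA; apply: setDS; apply/subsetP=> i /YA piA.
  by rewrite inE evalv_linform (sub_linform0 Aa piA) mxE eqxx.
Qed.

End Dependence.

(** * Size and collinearity of dependent sets of points *)

Section DistinctPoints.

Variables (F : fieldType) (b n : nat) (p : 'I_n -> 'rV[F]_b) (S : {set 'I_n}).
Hypothesis p_neq0 : forall i, i \in S -> p i != 0.
Hypothesis p_inj : {in S &, forall i j, (p i <= p j)%MS -> i = j}.

(** Residuating by a hyperplane through one point of the support but not through another lowers the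
    degree by one and removes at least one point. In degree 0 the constant form 1 shows that the
    coefficients sum to zero, so a nonempty support has two points. *)
Lemma card_supp_dep d c : dep p d c -> supp c \subset S ->
  (0 < #|supp c|)%N -> (d + 2 <= #|supp c|)%N.
Proof.
elim: d c => [|d IHd] c dc cS.
  rewrite lt0n cards_eq0 => /set0Pn[i0 i0c].
  have /eqP : \sum_i c i = 0.
    rewrite -[RHS](dc 1 (dhomog1 _ _)); apply: eq_bigr => i _.
    by rewrite /evalv meval1 mulr1.
  rewrite (bigID (mem (supp c))) /= [X in _ + X]big1 => [|i]; last first.
    by rewrite inE negbK => /eqP.
  rewrite addr0 (big_setD1 _ i0c) /=.
  case: (set_0Vmem (supp c :\ i0)) => [->|[j jc] _].
    by rewrite big_set0 addr0 => /eqP ci0; rewrite inE ci0 eqxx in i0c.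
  by rewrite (cardsD1 i0) i0c (cardsD1 j) jc.
case/card_gt0P => i ic; have iS := subsetP cS _ ic.
case: (set_0Vmem (supp c :\ i)) => [c1|[j /setD1P[jNi jc]]].
  (* A lone point is handled with the zero subspace: some linear form is nonzero there, and the
     residual, again of at most one point, contradicts the induction hypothesis. *)
  have [/(_ i ic)/submx0null pi0|[c' [dc' c'0 subY]]] :=
    dep_residual (0 : 'M_(1, b)) dc.
    by have := p_neq0 iS; rewrite pi0 eqxx.
  have := subY set0; rewrite sub0set setD0 => /(_ isT) sub'.
  have {}sub' : supp c' \subset supp c by apply: sub' => k; rewrite inE.
  have := IHd c' dc' (subset_trans sub' cS) c'0.
  by have := subset_leq_card sub'; rewrite (cardsD1 i (supp c)) ic c1 cards0;
    lia.
have [/(_ i ic)/(p_inj iS (subsetP cS _ jc)) ij|[c' [dc' c'0 subY]]] :=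
  dep_residual (p j) dc; first by rewrite ij eqxx in jNi.
have sub' : supp c' \subset supp c :\ j.
  by apply: subY => [|k]; rewrite ?sub1set // inE => /eqP->.
have := IHd c' dc' (subset_trans sub' (subset_trans (subD1set _ _) cS)) c'0.
by have := subset_leq_card sub'; rewrite (cardsD1 j (supp c)) jc; lia.
Qed.

Lemma card_supp_residual (d e : nat) (c c' : 'I_n -> F) (Y : {set 'I_n}) :
    dep p d c' -> supp c \subset S -> (0 < #|supp c'|)%N ->
    Y \subset supp c -> supp c' \subset supp c :\: Y ->
    (#|supp c| <= e)%N ->
  [/\ supp c' \subset S, (d + 2 <= #|supp c'|)%N & (#|supp c'| + #|Y| <= e)%N].
Proof.
move=> dc' cS c'0 Yc sub' le_c.
have c'S := subset_trans sub' (subset_trans (subsetDl _ _) cS).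
split=> //; first exact: card_supp_dep.
rewrite (leq_trans _ le_c) // -(cardsID Y (supp c)) (setIidPr Yc) addnC
  leq_add2l.
exact: subset_leq_card.
Qed.

(** Residuating by the line through two points leaves at most [2 * d - 1] points, which lie on some
    [L] by induction. Only the number of rows of [L] is prescribed, which leaves room for supports
    with fewer than two points. *)
Lemma dep_collinear d c : dep p d c -> supp c \subset S ->
    (#|supp c| <= 2 * d + 1)%N ->
  exists L : 'M[F]_(2, b), forall i, i \in supp c -> (p i <= L)%MS.
Proof.
elim: d c => [|d IHd] c dc cS le_c; have := card_supp_dep dc cS.
  case: posnP => [/eqP c0 _|_ /(_ isT)]; last by lia.
  by exists 0 => i; move: c0; rewrite cards_eq0 => /eqP ->; rewrite inE.
case: (set_0Vmem (supp c)) => [-> _|[i ic]].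
  by exists 0 => i; rewrite inE.
rewrite (cardsD1 i) ic => /(_ isT) c_ge.
have /card_gt0P[j] : (0 < #|supp c :\ i|)%N by lia.
rewrite in_setD1 => /andP[jNi jc]; pose L0 := col_mx (p i) (p j).
have ijP : [set i; j] \subset supp c by rewrite subUset !sub1set ic.
have [L0P|[c1 [dc1 c1_gt0 sub1]]] := dep_residual L0 dc; first by exists L0.
have {}sub1 := sub1 _ ijP.
have {}sub1 : supp c1 \subset supp c :\: [set i; j].
  apply: sub1 => k; rewrite !inE => /orP[]/eqP->;
    by rewrite /L0 -addsmxE ?addsmxSl ?addsmxSr.
have [c1S c1_ge c1_le] := card_supp_residual dc1 cS c1_gt0 ijP sub1 le_c.
rewrite cards2 eq_sym jNi in c1_le.
have [|L LP] := IHd c1 dc1 c1S; first by lia.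
have c1c : supp c1 \subset supp c := subset_trans sub1 (subsetDl _ _).
(* If [L] missed a point of the support, residuating by [L] would leave at least [d + 2] points
   besides the [d + 2] or more of [c1], exceeding [2 * d + 3]. *)
have [cL|[c2 [dc2 c2_gt0 sub2]]] := dep_residual L dc; first by exists L.
have {}sub2 := sub2 _ c1c LP.
have [_ c2_ge c2_le] := card_supp_residual dc2 cS c2_gt0 c1c sub2 le_c.
by lia.
Qed.

End DistinctPoints.

Lemma sub_col_mx (F : fieldType) (b r r1 r2 : nat) (x : 'M[F]_(r, b))
    (A : 'M_(r1, b)) (B : 'M_(r2, b)) :
  (x <= A)%MS || (x <= B)%MS -> (x <= col_mx A B)%MS.
Proof.
rewrite -addsmxE => /orP[] /submx_trans; apply; first exact: addsmxSl.
exact: addsmxSr.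
Qed.

(** * Coplanarity of small dependent sets of points *)

Section Coplanarity.

Variables (F : fieldType) (b n : nat) (p : 'I_n -> 'rV[F]_b) (S : {set 'I_n}).
Hypothesis p_neq0 : forall i, i \in S -> p i != 0.
Hypothesis p_inj : {in S &, forall i j, (p i <= p j)%MS -> i = j}.

Lemma rank_two_points i j : i \in S -> j \in S -> i != j ->
  (1 < \rank (col_mx (p i) (p j)))%N.
Proof.
move=> iS jS iNj; rewrite -addsmxE.
have lt1 : (p i < p i + p j)%MS.
  rewrite ltmxE addsmxSl addsmx_sub submx_refl /=.
  by apply: contra iNj => /(p_inj jS iS) ->.
by have := rank_ltmx lt1; rewrite rank_rV p_neq0.
Qed.

Lemma line_unique (L : 'M[F]_(2, b)) i j : i \in S -> j \in S -> i != j ->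
  (p i <= L)%MS -> (p j <= L)%MS -> (L <= col_mx (p i) (p j))%MS.
Proof.
move=> iS jS iNj iL jL.
have sL : (col_mx (p i) (p j) <= L)%MS by rewrite -addsmxE addsmx_sub iL jL.
rewrite -(mxrank_leqif_sup sL) eqn_leq mxrankS //=.
exact: leq_trans (rank_leq_row L) (rank_two_points iS jS iNj).
Qed.

Definition on_line (L : 'M[F]_(2, b)) (X : {set 'I_n}) : {set 'I_n} :=
  [set i in X | (p i <= L)%MS].

(* If the support is not coplanar, induction gives a line L with d + 1 points,
   and residuating by a plane through L gives a second such line L3.  A plane
   through L and a point of L3 then leaves a nonempty dependent set with too
   few points on L3. *)
Lemma dep_coplanar d c : dep p d c -> supp c \subset S ->
    (#|supp c| <= 3 * d)%N ->
  (exists A : 'M[F]_(3, b), forall i, i \in supp c -> (p i <= A)%MS) \/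
  (exists L : 'M[F]_(2, b), d + 2 <= #|on_line L (supp c)|)%N.
Proof.
elim: d c => [|d IHd] c dc cS le_c.
  left; exists 0 => i; move: le_c; rewrite leqn0 cards_eq0 => /eqP ->.
  by rewrite inE.
case: (posnP #|supp c|) => [/eqP|c_gt0].
  by rewrite cards_eq0 => /eqP->; left; exists 0 => i; rewrite inE.
have c_ge := card_supp_dep p_neq0 p_inj dc cS c_gt0.
set P := exists A : 'M_(3, b), _; set Q := exists L, _.
have lineP L : P \/ Q \/ (#|on_line L (supp c)| <= d + 2)%N.
  by case: (leqP #|on_line L (supp c)| (d + 2)) => H; right;
     [right | left; exists L; move: H; clear; lia].
have residual (A : 'M_(3, b)) (Y : {set 'I_n}) : Y \subset supp c ->
    (forall i, i \in Y -> (p i <= A)%MS) ->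
  P \/ exists c', [/\ dep p d c', supp c' \subset supp c :\: Y,
    supp c' \subset S, (d + 2 <= #|supp c'|)%N &
    (#|supp c'| + #|Y| <= 3 * d.+1)%N].
  move=> Yc YA; have [cA|[c' [dc' c'0 sub']]] := dep_residual A dc.
    by left; exists A.
  have {}sub' := sub' _ Yc YA.
  have [c'S c'_ge c'_le] :=
    card_supp_residual p_neq0 p_inj dc' cS c'0 Yc sub' le_c.
  by right; exists c'.
(* The residual by a plane through three points has at most [3 * d] points, so induction applies. If
   it lies in a plane [A], a second residual by [A] has at least [d + 2] points; hence the first has
   at most [2 * d + 1] and is collinear. *)
have lineEx : P \/ Q \/ exists L : 'M_(2, b),
    (d + 2 <= #|on_line L (supp c)|)%N.
  have [i ic] : exists i, i \in supp c by apply/card_gt0P.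
  have /card_gt0P[j] : (0 < #|supp c :\ i|)%N.
    by rewrite (cardsD1 i) ic in c_ge; move: c_ge; clear; lia.
  rewrite in_setD1 => /andP[jNi jc].
  have /card_gt0P[k] : (0 < #|supp c :\ i :\ j|)%N.
    by move: c_ge; rewrite (cardsD1 i) ic (cardsD1 j) in_setD1 jNi jc; clear;
      lia.
  rewrite !in_setD1 => /and3P[kNj kNi kc].
  have Yc : i |: [set j; k] \subset supp c by rewrite !subUset !sub1set ic jc.
  have cardY : #|i |: [set j; k]| = 3%N.
    by rewrite cardsU1 cards2 !inE ![i == _]eq_sym negb_or jNi kNi eq_sym kNj.
  have [|HP|[c1 [dc1 sub1 c1S c1_ge c1_le]]] :=
    residual (col_mx (col_mx (p i) (p j)) (p k)) _ Yc; last first.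
  - have {}c1_le : (#|supp c1| <= 3 * d)%N.
      by move: c1_le; rewrite cardY; clear; lia.
    have c1c : supp c1 \subset supp c := subset_trans sub1 (subsetDl _ _).
    have [[A AP]|[L LP]] := IHd c1 dc1 c1S c1_le.
      have [HP|[c2 [_ _ _ c2_ge c2_le]]] := residual A _ c1c AP; first by left.
      have [|L LP] := dep_collinear p_neq0 p_inj dc1 c1S.
        by move: c2_ge c2_le; clear; lia.
      right; right; exists L; apply: leq_trans c1_ge _; apply: subset_leq_card.
      by apply/subsetP=> l lc1; rewrite inE (subsetP c1c) // LP.
    right; right; exists L; apply: leq_trans LP _; apply: subset_leq_card.
    by apply/subsetP=> l; rewrite !inE => /andP[lc1 ->]; have:= subsetP c1c l;
      rewrite !inE lc1 => /(_ isT)->.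
  - by left.
  - move=> l; rewrite !inE => H; apply: (@sub_col_mx _ _ _ 2 1);
    case/or3P: H => /eqP->.
    + by apply/orP; left; apply: (@sub_col_mx _ _ _ 1 1); rewrite submx_refl.
    + by apply/orP; left; apply: (@sub_col_mx _ _ _ 1 1);
      rewrite submx_refl orbT.
    + by rewrite submx_refl orbT.
case: lineEx => [|[|[L L_ge]]]; [by left | by right |].
have [|[|L_le]] := lineP L; [by left | by right |].
have Lc (L' : 'M_(2, b)) : on_line L' (supp c) \subset supp c.
  by apply/subsetP=> l; rewrite inE => /andP[].
(* The plane spanned by [L] and [p i] removes at least [d + 3] points, and the at most [2 * d]
   remaining ones are collinear. *)
have addpoint i : i \in supp c :\: on_line L (supp c) -> P \/ exists c',
  [/\ dep p d c', supp c' \subset supp c :\: (i |: on_line L (supp c)),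
    supp c' \subset S, (d + 2 <= #|supp c'|)%N &
    exists L' : 'M_(2, b), forall j, j \in supp c' -> (p j <= L')%MS].
  move=> /setDP[ic iNL].
  have [||HP|[c' [dc' sub' c'S c'_ge c'_le]]] :=
    residual (col_mx L (p i)) (i |: on_line L (supp c)).
  - by rewrite subUset sub1set ic Lc.
  - move=> l; rewrite !inE => H; apply: (@sub_col_mx _ _ _ 2 1); move: H.
    by case/orP=> [/eqP->|/andP[_ ->]]; rewrite ?submx_refl ?orbT.
  - by left.
  - right; exists c'; split=> //; apply: (dep_collinear p_neq0 p_inj dc' c'S).
    by move: c'_le L_ge; rewrite cardsU1 iNL; clear; lia.
have [Q0 Q0P|allL] := pickP (fun i => i \in supp c :\: on_line L (supp c));
  last first.
  left; exists (col_mx L (0 : 'rV_b)) => i ic; apply: (@sub_col_mx _ _ _ 2 1).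
  by have := allL i; rewrite /= in_setD ic andbT => /negbFE;
    rewrite inE => /andP[_ ->].
have [|[c3 [dc3 sub3' c3S c3_ge [L3 L3P]]]] := addpoint _ Q0P; first by left.
have [|[|L3_le]] := lineP L3; [by left | by right |].
have c3c := subset_trans sub3' (subsetDl _ _).
have c3E : supp c3 = on_line L3 (supp c).
  apply/eqP; rewrite eqEcard; apply/andP; split; last exact: leq_trans c3_ge.
  by apply/subsetP=> l lc3; rewrite inE (subsetP c3c) // L3P.
have [Q3 Q3c] : exists i, i \in supp c3 by apply/card_gt0P; move: c3_ge; clear;
  lia.
have c3L : supp c3 \subset supp c :\: on_line L (supp c).
  by apply: subset_trans sub3' _; apply: setDS; apply: subsetUr.
have [|[c4 [dc4 sub4 c4S c4_ge [L4 L4P]]]] := addpoint _ (subsetP c3L _ Q3c);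
  first by left.
have c4c := subset_trans sub4 (subsetDl _ _).
(* Both supports avoid [L], which together with [supp c3] uses up at least [2 * d + 4] of the at
   most [3 * d + 3] points. Hence [supp c4] shares two points with [supp c3], and [L4] lies in
   [L3]. *)
have cap_ge : (2 <= #|supp c4 :&: supp c3|)%N.
  have : (#|supp c4 :\: supp c3| + #|supp c3| + #|on_line L (supp c)| <= #|supp
    c|)%N.
    rewrite -(cardsID (on_line L (supp c)) (supp c)) (setIidPr (Lc L)) addnC.
    rewrite leq_add2l addnC -(cardsID (supp c3) (supp c :\: _)) (setIidPr c3L).
    rewrite leq_add2l; apply: subset_leq_card; apply: setSD.
    by apply: subset_trans sub4 _; apply: setDS; apply: subsetUr.
  rewrite -(cardsID (supp c3) (supp c4)) in c4_ge; move: c4_ge c3_ge L_ge le_c;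
    clear; lia.
have [i ic] : exists i, i \in supp c4 :&: supp c3 by apply/card_gt0P;
  exact: ltnW.
have /card_gt0P[j] : (0 < #|(supp c4 :&: supp c3) :\ i|)%N.
  by move: cap_ge; rewrite (cardsD1 i) ic; clear; lia.
rewrite in_setD1 => /andP[jNi jc]; move: ic jc; rewrite !in_setI.
move=> /andP[ic4 ic3] /andP[jc4 jc3].
have L4L3 : (L4 <= L3)%MS.
  have iNj : i != j by rewrite eq_sym.
  have iS := subsetP c3S _ ic3; have jS := subsetP c3S _ jc3.
  apply: submx_trans (line_unique iS jS iNj (L4P _ ic4) (L4P _ jc4)) _.
  by rewrite -addsmxE addsmx_sub !L3P.
(* The plane defining [c4] contains [p Q3], so at most [d + 1] points of [L3] are left for
   [supp c4]. *)
have : supp c4 \subset on_line L3 (supp c) :\ Q3.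
  apply/subsetP=> l lc4; have := subsetP sub4 _ lc4.
  rewrite in_setD in_setU1 negb_or -andbA => /and3P[lNQ _ lc].
  by rewrite in_setD1 lNQ inE lc (submx_trans (L4P _ lc4)).
move/subset_leq_card; move: L3_le; rewrite -c3E (cardsD1 Q3) Q3c; move: c4_ge;
  clear; lia.
Qed.

End Coplanarity.

(** * Rank of the evaluation matrix *)

Section EvaluationMatrix.

Variables (F : fieldType) (b n : nat) (u : 'I_n -> 'rV[F]_b.+1).
Implicit Types (T : {set 'I_n}) (d : nat).

Local Notation r2f d := (@r2v F (dhomog b.+1 F d)).

Definition evrow T d (f : dhomog b.+1 F d) : 'rV[F]_#|T| :=
  \row_j evalv (u (enum_val j)) (mpoly_of_dhomog f).

Fact evrow_is_linear T d : linear (@evrow T d).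
Proof.
by move=> a f g; apply/rowP=> j; rewrite !mxE /= evalvD evalvZ.
Qed.

HB.instance Definition _ T d :=
  GRing.isLinear.Build F (dhomog b.+1 F d) 'rV[F]_#|T| _ (@evrow T d)
    (@evrow_is_linear T d).

Definition evmx T d : 'M[F]_('C(d + b, d), #|T|) :=
  lin1_mx (@evrow T d \o r2f d).

(** This is the Hilbert function of the points of [T], the [h(d)] of the introduction. *)
Definition rk T d : nat := \rank (evmx T d).

Lemma mul_evmx T d (v : 'rV_('C(d + b, d))) :
  v *m evmx T d = evrow T (r2f d v).
Proof. exact: (mul_rV_lin1 (@evrow T d \o r2f d) v). Qed.

Lemma v2r_evmx T d (f : dhomog b.+1 F d) : v2r f *m evmx T d = evrow T f.
Proof. by rewrite mul_evmx v2rK. Qed.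

Lemma evrow_sub T d (f : dhomog b.+1 F d) : (evrow T f <= evmx T d)%MS.
Proof. by rewrite -v2r_evmx submxMl. Qed.

Lemma evmx_subP T d (r : nat) (B : 'M_(r, #|T|)) :
  (forall f : dhomog b.+1 F d, (evrow T f <= B)%MS) -> (evmx T d <= B)%MS.
Proof. by move=> H; apply/rV_subP=> v /submxP[w ->]; rewrite mul_evmx. Qed.

Lemma evrow_eq0 T d (f : dhomog b.+1 F d) :
  reflect {in T, forall i, evalv (u i) f = 0} (evrow T f == 0).
Proof.
apply: (iffP eqP) => [/rowP f0 i iT|f0].
  by have := f0 (enum_rank_in iT i); rewrite !mxE enum_rankK_in.
by apply/rowP=> j; rewrite !mxE f0 // enum_valP.
Qed.

Lemma rk_le_dim T d : (rk T d <= 'C(d + b, d))%N.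
Proof. exact: rank_leq_row. Qed.

Lemma rk_le_card T d : (rk T d <= #|T|)%N.
Proof. exact: rank_leq_col. Qed.

Lemma vanishing_form T d : (rk T d < 'C(d + b, d))%N ->
  exists f : {mpoly F[b.+1]},
    [/\ f != 0, f \is d.-homog & {in T, forall i, evalv (u i) f = 0}].
Proof.
move=> lt_rk; have : kermx (evmx T d) != 0.
  by rewrite kermx_eq0 /row_free -/(rk T d) neq_ltn lt_rk.
case/rowV0Pn=> v /sub_kermxP v0 vN0.
exists (r2f d v); split.
- apply: contraNneq vN0 => v_eq0; rewrite -(@r2vK F (dhomog b.+1 F d) v).
  by rewrite (_ : r2f d v = 0) ?linear0 //; apply: val_inj.
- exact: dhomog_is_dhomog.
- by apply/evrow_eq0; rewrite -mul_evmx v0.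
Qed.

Lemma sum_enum_val T (c : 'I_n -> F) (G : 'I_n -> F) : supp c \subset T ->
  \sum_i c i * G i = \sum_(j < #|T|) c (enum_val j) * G (enum_val j).
Proof.
move=> cT; rewrite -(big_enum_val (A := pred_of_set T) (fun i => c i * G i)) /=.
rewrite [LHS](bigID (mem T)) /= [X in _ + X]big1 ?addr0 // => i iT.
by apply/eqP; rewrite mulf_eq0; apply/orP; left; apply: contraNT iT => ci;
   rewrite (subsetP cT) // inE.
Qed.

(** A relation is a nonzero column vector annihilated by the evaluation matrix, with its entries
    placed on [T]. *)
Lemma rk_lt_card T d : (rk T d < #|T|)%N <->
  exists c, [/\ dep u d c, supp c \subset T & (0 < #|supp c|)%N].
Proof.
split=> [lt_rk|[c [dc cT /card_gt0P[i ic]]]]; last first.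
  rewrite ltn_neqAle rk_le_card andbT; apply/negP=> full.
  pose w : 'cV_#|T| := \col_j c (enum_val j).
  have : evmx T d *m w = 0.
    apply/row_matrixP=> k; rewrite row_mul rowE mul_evmx row0.
    apply/rowP=> k'; rewrite !mxE.
    rewrite -[RHS](dc _ (dhomog_is_dhomog (r2f d (delta_mx 0 k)))).
    by rewrite (sum_enum_val _ cT); apply: eq_bigr => j _; rewrite !mxE mulrC.
  rewrite -(mulmx0 _ (evmx T d)) => /(row_full_inj full) /colP w0.
  have iT := subsetP cT _ ic; have := w0 (enum_rank_in iT i).
  by rewrite !mxE enum_rankK_in // => ci; rewrite inE ci eqxx in ic.
have /matrix0Pn[j0 [k wN0]] : cokermx (evmx T d) != 0.
  by rewrite cokermx_eq0 /row_full -/(rk T d) neq_ltn lt_rk.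
pose w := col k (cokermx (evmx T d)).
have Ew : evmx T d *m w = 0 by rewrite /w colE mulmxA mulmx_coker mul0mx.
(* This sum has one term for [i] in [T] and none otherwise: it extends [w] by zero. *)
pose c i := \sum_(j < #|T| | enum_val j == i) w j 0.
have cE j : c (enum_val j) = w j 0.
  by rewrite /c (eq_bigl (pred1 j)) ?big_pred1_eq // => j';
    apply: (inj_eq enum_val_inj).
have cT : supp c \subset T.
  apply/subsetP=> i; rewrite inE; apply: contraNT => iT; apply/eqP.
  by apply: big1 => j /eqP ji; rewrite -ji enum_valP in iT.
exists c; split=> //.
- move=> f hf; rewrite (sum_enum_val _ cT).
  have := congr1 (mulmx (v2r (DHomog hf))) Ew.
  rewrite mulmxA v2r_evmx mulmx0 => /matrixP/(_ 0 0).
  rewrite mxE [RHS]mxE => E; rewrite -[RHS]E.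
  by apply: eq_bigr => j _; rewrite cE !mxE mulrC.
- by apply/card_gt0P; exists (enum_val j0); rewrite inE cE mxE.
Qed.

(** The relation says that the two evaluation matrices are orthogonal for the bilinear form with
    diagonal matrix [D], which is nondegenerate because [c] vanishes nowhere on [T]. *)
Lemma rk_pairing T d e c : dep u (d + e) c -> supp c = T ->
  (rk T d + rk T e <= #|T|)%N.
Proof.
move=> dc cT; pose D := diag_mx (\row_(j < #|T|) c (enum_val j)).
have uD : D \in unitmx.
  rewrite unitmxE det_diag unitfE; apply/prodf_neq0 => j _; rewrite mxE.
  by have := enum_valP j; rewrite -{2}cT inE.
rewrite -[rk T e]mxrank_tr /rk -(mxrankMfree (evmx T d) (B := D))
  ?row_free_unit //.
apply: mulmx0_rank_max; apply/row_matrixP=> k; rewrite !row_mul row0 rowE.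
rewrite mul_evmx -[RHS]trmx0; apply: trmx_inj; rewrite trmxK trmx_mul trmxK.
apply/row_matrixP=> l; rewrite row_mul row0 rowE mul_evmx.
apply/rowP=> l'; rewrite ord1 !mxE.
set f := r2f e _; set g := r2f d _.
rewrite -[RHS](dc _ (dhomogM (dhomog_is_dhomog g) (dhomog_is_dhomog f))).
rewrite (@sum_enum_val T) ?cT //; apply: eq_bigr => j _.
by rewrite [X in _ * X]mxE /D mul_mx_diag !mxE evalvM; ring.
Qed.

Lemma rk_subset T T' d : T' \subset T -> (rk T' d <= rk T d)%N.
Proof.
move=> sT; pose M : 'M[F]_(#|T|, #|T'|) :=
  \matrix_(j, j') (enum_val j == enum_val j')%:R.
have -> : rk T' d = \rank (evmx T d *m M); last exact: mxrankM_maxl.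
congr (\rank _); apply/row_matrixP=> k; rewrite row_mul !rowE !mul_evmx.
apply/rowP=> j'; rewrite !mxE; set i := enum_val j'.
have iT : i \in T by apply: (subsetP sT); apply: enum_valP.
rewrite (bigD1 (enum_rank_in iT i)) //= !mxE enum_rankK_in // eqxx mulr1.
rewrite big1 ?addr0 // => j jN; rewrite !mxE; case: eqP => [ji|_];
  last exact: mulr0.
by case/eqP: jN; apply: enum_val_inj; rewrite enum_rankK_in.
Qed.

(** By minimality, [T] with one point removed carries no relation and imposes independent
    conditions. *)
Lemma rk_circuit T d :
  (forall c, dep u d c -> supp c \subset T -> (0 < #|supp c|)%N ->
     (#|T| <= #|supp c|)%N) ->
  (#|T| <= (rk T d).+1)%N.
Proof.
move=> minT; case: (set_0Vmem T) => [->|[i iT]]; first by rewrite cards0.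
have sT : T :\ i \subset T by apply: subD1set.
apply: leq_trans (_ : (rk (T :\ i) d).+1 <= _)%N; last exact: rk_subset.
rewrite (cardsD1 i) iT ltnS leqNgt; apply/negP=> /rk_lt_card[c [dc cT c0]].
have := minT c dc (subset_trans cT sT) c0; have := subset_leq_card cT.
by rewrite (cardsD1 i T) iT; clear; lia.
Qed.

(** [Q] is the matrix of multiplication by [q], which is injective since polynomials form a domain.
    Its row space is the space of multiples of [q]. *)
Lemma mul_form_mx d e (q : {mpoly F[b.+1]}) : q != 0 -> q \is e.-homog ->
  exists2 Q : 'M[F]_('C(d + b, d), 'C(d + e + b, d + e)), row_free Q &
    forall v, mpoly_of_dhomog (r2f (d + e) (v *m Q)) =
              q * mpoly_of_dhomog (r2f d v).
Proof.
move=> qN0 hq.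
have hmul (g : dhomog b.+1 F d) : q * mpoly_of_dhomog g \is (d + e).-homog.
  by rewrite mulrC dhomogM // dhomog_is_dhomog.
pose mulq (g : dhomog b.+1 F d) : dhomog b.+1 F (d + e) := DHomog (hmul g).
have mulq_lin : linear mulq.
  by move=> a f g; apply: val_inj; rewrite /= mulrDr -scalerAr.
pose lQ := GRing.isLinear.Build F (dhomog b.+1 F d) (dhomog b.+1 F (d + e)) _
  mulq mulq_lin.
pose L : {linear _ -> _} := HB.pack mulq lQ.
pose Q := lin1_mx (v2r \o (L \o r2f d)).
have QE v :
    mpoly_of_dhomog (r2f (d + e) (v *m Q)) = q * mpoly_of_dhomog (r2f d v).
  by rewrite (mul_rV_lin1 (v2r \o (L \o r2f d)) v) /= v2rK.
exists Q => //; rewrite -kermx_eq0; apply/rowV0P=> v /sub_kermxP v0.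
have /eqP := QE v; rewrite v0 linear0 eq_sym mulf_eq0 (negPf qN0) /=.
move=> /eqP rv; rewrite -(@r2vK F (dhomog b.+1 F d) v).
by rewrite (_ : r2f d v = 0) ?linear0 //; apply: val_inj.
Qed.

Lemma rk_le_mul T d e (q : {mpoly F[b.+1]}) : q != 0 -> q \is e.-homog ->
    {in T, forall i, evalv (u i) q = 0} ->
  (rk T (d + e) + 'C(d + b, d) <= 'C(d + e + b, d + e))%N.
Proof.
move=> qN0 hq q0; have [Q freeQ QE] := mul_form_mx d qN0 hq.
rewrite addnC -(eqP freeQ : \rank Q = _); apply: mulmx0_rank_max.
apply/row_matrixP=> k; rewrite row_mul rowE row0 mul_evmx; apply/eqP/evrow_eq0.
by move=> i iT; rewrite QE evalvM q0 ?mul0r.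
Qed.

(** The multiples of [q] lie in the kernel of evaluation on [T], and the dimension hypothesis makes
    them fill it. *)
Lemma vanishing_multiple T d e (q g : {mpoly F[b.+1]}) :
    q != 0 -> q \is e.-homog -> {in T, forall i, evalv (u i) q = 0} ->
    g \is (d + e).-homog -> {in T, forall i, evalv (u i) g = 0} ->
    ('C(d + e + b, d + e) <= rk T (d + e) + 'C(d + b, d))%N ->
  exists2 h, h \is d.-homog & g = q * h.
Proof.
move=> qN0 hq q0 hg g0 dim; have [Q freeQ QE] := mul_form_mx d qN0 hq.
have QK : (Q <= kermx (evmx T (d + e)))%MS.
  apply/sub_kermxP; apply/row_matrixP=> k; rewrite row_mul rowE row0 mul_evmx.
  by apply/eqP/evrow_eq0 => i iT; rewrite QE evalvM q0 ?mul0r.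
have KQ : (kermx (evmx T (d + e)) <= Q)%MS.
  rewrite -(mxrank_leqif_sup QK) eqn_leq mxrankS //= mxrank_ker
    (eqP freeQ : \rank Q = _).
  by rewrite leq_subLR.
have : (v2r (DHomog hg) <= Q)%MS.
  by apply: submx_trans KQ; apply/sub_kermxP; rewrite v2r_evmx;
    apply/eqP/evrow_eq0.
case/submxP=> v vE; exists (r2f d v); first exact: dhomog_is_dhomog.
by rewrite -QE -vE v2rK.
Qed.

Lemma exists_nonmultiple T d e (q : {mpoly F[b.+1]}) :
    q != 0 -> q \is e.-homog ->
    (rk T (d + e) + 'C(d + b, d) < 'C(d + e + b, d + e))%N ->
  exists g, [/\ g \is (d + e).-homog, {in T, forall i, evalv (u i) g = 0} &
    ~ exists2 h, h \is d.-homog & g = q * h].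
Proof.
move=> qN0 hq dim; have [Q freeQ QE] := mul_form_mx d qN0 hq.
have : ~~ (kermx (evmx T (d + e)) <= Q)%MS.
  apply/negP=> /mxrankS; rewrite mxrank_ker (eqP freeQ : \rank Q = _).
  by rewrite leqNgt ltn_subRL dim.
case/row_subPn=> k; set v := row k _ => vNQ.
exists (r2f (d + e) v); split; first exact: dhomog_is_dhomog.
  apply/evrow_eq0; rewrite -mul_evmx; apply/eqP/sub_kermxP.
  exact: row_sub.
case=> h hh gE; case/negP: vNQ; apply/submxP; exists (v2r (DHomog hh)).
apply: (can_inj (@r2vK F (dhomog b.+1 F (d + e)))).
by apply: val_inj; rewrite /= QE v2rK.
Qed.

End EvaluationMatrix.

(** * Concavity of the Hilbert function *)

Lemma closed_avoid (K : closedFieldType) (s : seq K) : exists x, x \notin s.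
Proof.
have /closed_nonrootP[x] : \prod_(a <- s) ('X - a%:P) != 0 :> {poly K}.
  by rewrite monic_neq0 // monic_prod_XsubC.
by rewrite root_prod_XsubC; exists x.
Qed.

(** [muni] views [f] as a polynomial in its last variable. Recovering the coefficients of [f] shows
    that [muni] kills no nonzero [f]. *)
Lemma muni_coef (K : fieldType) (n : nat) (f : {mpoly K[n.+1]})
    (mo : 'X_{1..n.+1}) :
  ((muni f)`_(mo ord_max))@_[multinom mo (widen_ord (leqnSn n) i) | i < n] =
  f@_mo.
Proof.
rewrite muniE coef_sum raddf_sum /=.
have E (mo' : 'X_{1..n.+1}) :
    ((f@_mo' *: 'X_[[multinom mo' (widen_ord (leqnSn n) i) | i < n]] *:
      'X^(mo' ord_max))`_(mo ord_max))@_
      [multinom mo (widen_ord (leqnSn n) i) | i < n] =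
    f@_mo' * (mo' == mo)%:R.
  rewrite coefZ coefXn mulr_natr; case: (eqVneq mo' mo) => [->|neq].
    by rewrite eqxx mulr1n mcoeffZ mcoeffX eqxx.
  rewrite mulr0; case: eqP => [eq_max|]; last by rewrite mulr0n mcoeff0.
  rewrite mulr1n mcoeffZ mcoeffX; case: eqP => [/mnmP eq_wid|];
    last by rewrite mulr0.
  case/eqP: neq; apply/mnmP=> i; case: (unliftP ord_max i) => [j|] ->.
    by have := eq_wid j; rewrite !mnmE => ?;
      rewrite (_ : lift _ _ = widen_ord (leqnSn n) j) //; apply: val_inj;
        rewrite /= /bump leqNgt ltn_ord.
  by [].
under eq_bigr => mo' _ do rewrite E.
case: (boolP (mo \in msupp f)) => [mo_f|mo_f].
  rewrite (bigD1_seq mo) ?msupp_uniq //= eqxx mulr1 big1 ?addr0 // => mo' neq.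
  by rewrite (negPf neq) mulr0.
rewrite big_seq big1 => [|mo' mo'f]; first by rewrite memN_msupp_eq0.
by case: eqP => [eq|]; rewrite ?mulr0 // -eq mo'f in mo_f *.
Qed.

(** Induction on the number of variables: choose [v] where the leading coefficient in the last
    variable is nonzero, then a value [t] of that variable which is not a root. *)
Lemma mpoly_nonvanishing (K : closedFieldType) (n : nat) (f : {mpoly K[n]}) :
  f != 0 -> exists x, evalv x f != 0.
Proof.
elim: n f => [|n IHn] f fN0.
  have fC : f = (f@_0)%:MP.
    apply/mpolyP=> mo; have -> : mo = 0%MM by apply/mnmP; case.
    by rewrite mcoeffC eqxx mulr1.
  exists 0; rewrite fC /evalv mevalC.
  by apply: contraNneq fN0 => f00; rewrite fC f00 mpolyC0.
have : muni f != 0.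
  apply: contraNneq fN0 => muni0; rewrite -mleadc_eq0 -muni_coef muni0.
  by rewrite coef0 mcoeff0.
rewrite -lead_coef_eq0 => /IHn[v vN0].
pose q := map_poly (meval (fun i => v 0 i)) (muni f).
have : q != 0.
  apply: contraNneq vN0 => q0; rewrite /evalv lead_coefE.
  by rewrite -(coef_map (meval (fun i => v 0 i))) -/q q0 coef0.
case/closed_nonrootP=> t; rewrite /root => tN0.
exists (\row_i oapp (fun j => v 0 j) t (unlift ord_max i)).
suff -> : evalv (\row_i oapp (fun j => v 0 j) t (unlift ord_max i)) f = q.[t]
  by [].
rewrite /evalv mevalE /q muniE rmorph_sum horner_sum; apply: eq_bigr => mo _.
rewrite -mul_polyC rmorphM /= map_polyC map_polyXn hornerM hornerC hornerXn /=.
rewrite mevalZ mevalX -mulrA; congr (_ * _); rewrite big_ord_recr /=;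
  congr (_ * _).
  apply: eq_bigr => j _; rewrite mnmE mxE.
  have -> : widen_ord (leqnSn n) j = lift ord_max j.
    by apply: val_inj; rewrite /= /bump leqNgt ltn_ord.
  by rewrite liftK.
by rewrite mxE unlift_none.
Qed.

Section Generic.

Variables (K : closedFieldType) (n : nat) (u : 'I_n -> 'rV[K]_3).
Variable T : {set 'I_n}.
Hypothesis u_neq0 : forall i, i \in T -> u i != 0.

(* As f vanishes on T, two general lines x and y through a point O off the
   curve f = 0 avoid T. *)
Lemma generic_coordinates d (f : {mpoly K[3]}) : f != 0 -> f \is d.+1.-homog ->
    {in T, forall i, evalv (u i) f = 0} ->
  exists x y z : 'cV[K]_3, [/\
    {in T, forall i, (u i *m x) 0 0 != 0 /\ (u i *m y) 0 0 != 0},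
    forall v : 'cV[K]_3, exists a b e, v = a *: x + b *: y + e *: z &
    exists O : 'rV_3, [/\ O *m x = 0, O *m y = 0 & evalv O f != 0]].
Proof.
move=> fN0 hf f0; have [O ON0] := mpoly_nonvanishing fN0.
have O_neq0 : O != 0.
  apply: contraNneq ON0 => ->; rewrite -(scale0r 0) (evalv_scale _ _ hf).
  by rewrite exprS !mul0r.
pose G := invmx (row_ebase O).
(* The columns of [G] form a basis of the linear forms, and [O] has coordinates [(s, 0, 0)] in it.
   Thus [a0] and [b0] define lines through [O], and they have no common zero on [T] because [f]
   vanishes on [T] but not at [O]. *)
have Ginv (v : 'cV[K]_3) : exists w, v = G *m w.
  by exists (row_ebase O *m v); rewrite mulmxA mulVmx ?mul1mx ?row_ebase_unit.
have unitG : G \in unitmx by rewrite unitmx_inv row_ebase_unit.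
pose s := col_ebase O 0 0.
have OG : O *m G = s *: delta_mx 0 0.
  rewrite -{1}(mulmx_ebase O) mulmxK ?row_ebase_unit // rank_rV O_neq0.
  apply/rowP=> j; rewrite !mxE big_ord_recl big_ord0 !mxE addr0 /=.
  by rewrite andbT; case: j => [[|j] ?].
have sN0 : s != 0.
  apply: contraNneq O_neq0 => s0; rewrite -(mulmxK unitG O) OG s0.
  by rewrite scale0r mul0mx.
pose g j := col j G.
have gE j (w : 'rV_3) : (w *m g j) 0 0 = (w *m G) 0 j.
  by rewrite /g colE mulmxA -colE mxE.
pose a0 := g (inord 1); pose b0 := g (inord 2).
have rowE (w : 'rV[K]_3) :
    w = \row_j [:: w 0 0; w 0 (inord 1); w 0 (inord 2)]`_j.
  apply/rowP=> -[[|[|[|//]]] lt_j]; rewrite mxE /=; congr (w _ _);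
    by apply: val_inj; rewrite /= ?inordK.
have ab i : i \in T -> ((u i *m a0) 0 0 != 0) || ((u i *m b0) 0 0 != 0).
  move=> iT; rewrite -negb_and; apply/negP;
    rewrite !gE => /andP[/eqP a00 /eqP b00].
  have uE : u i = ((u i *m G) 0 0 / s) *: O.
    apply: (can_inj (mulmxK unitG)); rewrite -scalemxAl OG scalerA divfK //.
    rewrite [LHS]rowE a00 b00; apply/rowP=> -[[|[|[|//]]] lt_j];
    by rewrite !mxE /= ?mulr1 ?mulr0.
  have /eqP := f0 i iT; rewrite uE (evalv_scale _ _ hf) mulf_eq0 (negPf ON0)
    orbF.
  rewrite expf_eq0 /= => /eqP w0; have := u_neq0 iT.
  by rewrite uE w0 scale0r eqxx.
(* The form [a0 + t *: b0] can vanish at [u i] only for [t = bad i]. If [b0] vanishes there, the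
   division yields the harmless value 0, since [a0] is then nonzero. Taking [t2] different from [t1]
   makes the two forms independent. *)
pose bad i := - ((u i *m a0) 0 0 / (u i *m b0) 0 0).
have [t1 t1P] := closed_avoid [seq bad i | i <- enum T].
have [t2 t2P] := closed_avoid (t1 :: [seq bad i | i <- enum T]).
have goodt t : t \notin [seq bad i | i <- enum T] ->
    {in T, forall i, (u i *m (a0 + t *: b0)) 0 0 != 0}.
  move=> tP i iT; rewrite mulmxDr mxE -scalemxAr [X in _ + X]mxE.
  have := ab i iT; case: (eqVneq ((u i *m b0) 0 0) 0) => [->|bN0 _].
    by rewrite orbF mulr0 addr0.
  apply: contra tP; rewrite addr_eq0 => /eqP aE; apply/mapP; exists i.
    by rewrite mem_enum.
  by rewrite /bad aE mulNr opprK mulfK.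
exists (a0 + t1 *: b0), (a0 + t2 *: b0), (g 0).
have t12 : t2 - t1 != 0.
  by rewrite subr_eq0; apply: contraNneq t2P => ->; rewrite mem_head.
split.
- move=> i iT; split; apply: goodt => //.
  by apply: contra t2P => t2bad; rewrite inE t2bad orbT.
- move=> v; have [w ->] := Ginv v.
  pose w0 := w 0 0; pose w1 := w (inord 1) 0; pose w2 := w (inord 2) 0.
  pose be := (w2 - t1 * w1) / (t2 - t1).
  exists (w1 - be), be, w0; apply/colP=> j; rewrite !mxE !big_ord_recl big_ord0.
  have -> : lift ord0 ord0 = inord 1 :> 'I_3.
    by apply: val_inj; rewrite /= inordK.
  have -> : lift ord0 (lift ord0 ord0) = inord 2 :> 'I_3.
    by apply: val_inj; rewrite /= inordK.
  by rewrite -/w0 -/w1 -/w2 /be; field.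
- have OgE k : k != 0 -> O *m g k = 0.
    move=> kN0; apply/colP=> j; rewrite !ord1 gE OG !mxE (negPf kN0).
    by rewrite andbF mulr0.
  exists O; split=> //; rewrite mulmxDr -scalemxAr !OgE ?scaler0 ?addr0 //;
    by rewrite -val_eqE /= inordK.
Qed.

End Generic.

Lemma homog0_const (F : fieldType) b (f : {mpoly F[b]}) :
  f \is 0.-homog -> f = (f@_0)%:MP.
Proof.
move=> hf; apply/mpolyP=> mo; rewrite mcoeffC.
case: (eqVneq mo 0%MM) => [->|mo0]; rewrite ?mulr1 ?mulr0 //.
by apply: (dhomog_nemf_coeff hf); rewrite /= mdeg_eq0.
Qed.

(** * Forms modulo two linear forms *)

Section Decomposition.

Variables (F : fieldType) (b : nat).
Implicit Types (f g : {mpoly F[b]}).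

Lemma linform_comb (x y z : 'cV[F]_b) (r s t : F) :
  linform (r *: x + s *: y + t *: z) =
  r *: linform x + s *: linform y + t *: linform z.
Proof.
rewrite /linform !scaler_sumr -!big_split /=; apply: eq_bigr => j _.
by rewrite !mxE !scalerA !scalerDl.
Qed.

Lemma linform_delta j : linform (delta_mx j 0) = 'X_j :> {mpoly F[b]}.
Proof.
rewrite /linform (bigD1 j) //= mxE !eqxx scale1r big1 ?addr0 // => i iNj.
by rewrite mxE (negPf iNj) scale0r.
Qed.

(** Every monomial of positive degree is divisible by a variable. *)
Lemma homog_ind (d : nat) (Q : {mpoly F[b]} -> Prop) :
    Q 0 -> (forall f g, Q f -> Q g -> Q (f + g)) ->
    (forall f (j : 'I_b), f \is d.-homog -> Q (f * 'X_j)) ->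
  forall f, f \is d.+1.-homog -> Q f.
Proof.
move=> Q0 QD QX f hf; rewrite (mpolyE f) big_seq;
  apply: (big_ind Q) => // mo mo_f.
have : mdeg mo = d.+1 := dhomogP _ _ _ hf mo mo_f.
case: (pickP (fun j => mo j != 0%N)) => [j mo_j|mo0]; last first.
  by rewrite mdegE big1 // => j _; apply/eqP; have := mo0 j; move/negbFE.
have le : (U_(j) <= mo)%MM by rewrite lep1mP.
rewrite -(submK le) mdegD mdeg1 addn1 => -[deg].
rewrite mpolyXD scalerAl; apply: QX; apply: rpredZ.
by rewrite dhomogX; apply/eqP.
Qed.

(** Modulo [x] and [y] every form is a multiple of a power of [z]. In the induction a variable is
    written in terms of [x], [y], [z], and the hypothesis is applied only to the factor multiplied
    by [z]. *)
Lemma homog_decomposition (x y z : 'cV[F]_b) d f :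
    (forall v : 'cV[F]_b, exists r s t, v = r *: x + s *: y + t *: z) ->
    f \is d.+1.-homog ->
  exists g h t, [/\ g \is d.-homog, h \is d.-homog &
    f = linform x * g + linform y * h + t *: linform z ^+ d.+1].
Proof.
move=> span; elim: d f => [|d IHd]; apply: homog_ind.
- by exists 0, 0, 0; rewrite rpred0 !mulr0 scale0r !addr0.
- move=> f1 f2 [g1 [h1 [t1 [hg1 hh1 ->]]]] [g2 [h2 [t2 [hg2 hh2 ->]]]].
  exists (g1 + g2), (h1 + h2), (t1 + t2).
  by rewrite !rpredD // !mulrDr scalerDl; split=> //; ring.
- move=> f j hf; have [r [s [t jE]]] := span (delta_mx j 0).
  exists (r *: f), (s *: f), (t * f@_0); split; try exact: rpredZ.
  rewrite -linform_delta jE linform_comb expr1.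
  rewrite !mulrDr -!scalerAr ![f * _]mulrC; congr (_ + _).
  by rewrite -scalerA -[f@_0 *: _]mul_mpolyC -homog0_const // mulrC.
- by exists 0, 0, 0; rewrite rpred0 !mulr0 scale0r !addr0.
- move=> f1 f2 [g1 [h1 [t1 [hg1 hh1 ->]]]] [g2 [h2 [t2 [hg2 hh2 ->]]]].
  exists (g1 + g2), (h1 + h2), (t1 + t2).
  by rewrite !rpredD // !mulrDr scalerDl; split=> //; ring.
- move=> f j /[dup] hf /IHd[g [h [e [hg hh fE]]]].
  have [r [s [t jE]]] := span (delta_mx j 0).
  have lz := linform_homog z.
  exists (r *: f + t *: (g * linform z)), (s *: f + t *: (h * linform z)).
  exists (t * e).
  rewrite !rpredD ?rpredZ // -?[d.+1]addn1 ?dhomogM //; split=> //.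
  rewrite -linform_delta jE linform_comb exprS.
  rewrite !mulrDr -!scalerAr ![f * _]mulrC.
  have -> : linform z * f = linform x * (g * linform z) +
      linform y * (h * linform z) + e *: (linform z * linform z ^+ d.+1).
    rewrite {1}fE !mulrDr -scalerAr; congr (_ + _ + _).
      by rewrite mulrCA [linform z * g]mulrC.
    by rewrite mulrCA [linform z * h]mulrC.
  rewrite !scalerDr scalerA addrACA -!addrA; congr (_ + (_ + _)).
  by rewrite addrCA addn1.
Qed.

End Decomposition.

Section HilbertFunction.

Variables (K : closedFieldType) (n : nat) (u : 'I_n -> 'rV[K]_3).
Variable T : {set 'I_n}.
Hypothesis u_neq0 : forall i, i \in T -> u i != 0.

(* Writing H_d for the image of evaluation in degree d, f gives
   H_(d+2) = x H_(d+1) + y H_(d+1), and both summands contain x y H_d. *)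
Lemma rk_concave e d (f : {mpoly K[3]}) : f != 0 -> f \is e.+1.-homog ->
    {in T, forall i, evalv (u i) f = 0} -> (e <= d.+1)%N ->
  (rk u T d.+2 + rk u T d <= 2 * rk u T d.+1)%N.
Proof.
move=> fN0 hf f0 le_ed.
have [x [y [z [xyP span [O [Ox Oy fO]]]]]] :=
  generic_coordinates u_neq0 fN0 hf f0.
pose D (a : 'cV[K]_3) := diag_mx (\row_(j < #|T|) (u (enum_val j) *m a) 0 0).
have unitD a : {in T, forall i, (u i *m a) 0 0 != 0} -> D a \in unitmx.
  move=> aP; rewrite unitmxE det_diag unitfE; apply/prodf_neq0 => j _.
  by rewrite mxE aP // enum_valP.
have uDx : D x \in unitmx by apply: unitD => i /xyP[].
have uDy : D y \in unitmx by apply: unitD => i /xyP[].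
have ev_lin a k (g : dhomog 3 K k) :
    evrow u T g *m D a =
      \row_j evalv (u (enum_val j)) (linform a * mpoly_of_dhomog g).
  by apply/rowP=> j; rewrite mul_mx_diag [RHS]mxE evalvM evalv_linform mxE
    mulrC; congr (_ * _); rewrite mxE.
have ev_sub a k (g : {mpoly K[3]}) : g \is k.-homog ->
    (\row_j evalv (u (enum_val j)) (linform a * g) <= evmx u T k *m D a)%MS.
  by move=> hg; have := submxMr (D a) (evrow_sub u T (DHomog hg));
    rewrite ev_lin.
pose V := (evmx u T d.+1 *m D x + evmx u T d.+1 *m D y)%MS.
have subV (g h : {mpoly K[3]}) : g \is d.+1.-homog -> h \is d.+1.-homog ->
    (\row_(j < #|T|) evalv (u (enum_val j)) (linform x * g + linform y * h)
      <= V)%MS.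
  move=> hg hh; rewrite (_ : \row_j _ =
     \row_j evalv (u (enum_val j)) (linform x * g) +
     \row_j evalv (u (enum_val j)) (linform y * h)); last first.
    by apply/rowP=> j; rewrite !mxE evalvD.
  by apply: addmx_sub_adds; apply: ev_sub.
(* At [O] the forms [x] and [y] vanish while [f] does not, so the power of [z] occurs in [f] with a
   nonzero coefficient. As [f] is zero on [T], that power can be expressed there through [x] and
   [y]; multiplying by a further power of [z] reaches degree [d.+2]. *)
have zV : (\row_(j < #|T|) evalv (u (enum_val j)) (linform z ^+ d.+2) <= V)%MS.
  have [g [h [t [hg hh fE]]]] := homog_decomposition span hf.
  have tN0 : t != 0.
    apply: contraNneq fO => t0.
    by rewrite fE t0 scale0r addr0 evalvD !evalvM !evalv_linform Ox Oy !mxE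
      !mul0r addr0.
  have hz k : linform z ^+ k \is k.-homog.
    by rewrite -{2}[k]muln1 dhomogXn ?linform_homog.
  have deg : (e + (d.+1 - e))%N = d.+1 by rewrite subnKC.
  have hg' : - t^-1 *: (g * linform z ^+ (d.+1 - e)) \is d.+1.-homog.
    by rewrite rpredZ // -deg dhomogM // deg.
  have hh' : - t^-1 *: (h * linform z ^+ (d.+1 - e)) \is d.+1.-homog.
    by rewrite rpredZ // -deg dhomogM // deg.
  have := subV _ _ hg' hh'; congr (_ <= _)%MS; apply/rowP=> j; rewrite !mxE.
  have jT : enum_val j \in T by apply: enum_valP.
  have := f0 _ jT; rewrite fE !evalvXn !evalvD !evalvZ !evalvXn !evalvM !evalvZ
    !evalvM !evalvXn.
  have -> : d.+2 = (e.+1 + (d.+1 - e))%N by rewrite addSn deg.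
  rewrite exprD; set X := evalv _ (linform x); set Y := evalv _ (linform y).
  set Z := evalv _ (linform z); set G := evalv _ g; set H := evalv _ h => E0.
  apply: (mulfI tN0).
  transitivity (Z ^+ (d.+1 - e) * (t * Z ^+ e.+1)); last by ring.
  have -> : t * Z ^+ e.+1 = - (X * G + Y * H).
    by apply/eqP; rewrite -addr_eq0 addrC E0.
  by field.
have rkV : (evmx u T d.+2 <= V)%MS.
  apply: evmx_subP => g; have hg := dhomog_is_dhomog g.
  have [g1 [h1 [t [hg1 hh1 gE]]]] := homog_decomposition span hg.
  rewrite (_ : evrow u T g =
    \row_j evalv (u (enum_val j)) (linform x * g1 + linform y * h1) +
    t *: \row_j evalv (u (enum_val j)) (linform z ^+ d.+2)); last first.
    by apply/rowP=> j; rewrite !mxE gE evalvD evalvZ.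
  by rewrite addmx_sub ?subV // scalemx_sub.
have step a : (evmx u T d *m D a <= evmx u T d.+1)%MS.
  apply/row_subP=> k; rewrite row_mul rowE mul_evmx ev_lin.
  set g := r2v _.
  have hg : linform a * mpoly_of_dhomog g \is d.+1.-homog.
    by rewrite -[d.+1]add1n dhomogM ?linform_homog ?dhomog_is_dhomog.
  exact: (evrow_sub u T (DHomog hg)).
have capP : (evmx u T d *m D x *m D y <=
             evmx u T d.+1 *m D x :&: evmx u T d.+1 *m D y)%MS.
  by rewrite sub_capmx (submxMr (D y) (step x)) andbT -mulmxA diag_mxC mulmxA
    (submxMr (D x) (step y)).
have := mxrank_sum_cap (evmx u T d.+1 *m D x) (evmx u T d.+1 *m D y).
have := mxrankS rkV; have := mxrankS capP.
rewrite -/V !mxrankMfree ?row_free_unit // -/(rk u T d) -/(rk u T d.+2).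
by rewrite -/(rk u T d.+1); clear; lia.
Qed.

End HilbertFunction.

(** * Minimal linked sets in a plane *)

Lemma dim3S d : 'C(d.+1 + 2, d.+1) = ('C(d + 2, d) + d + 2)%N.
Proof.
have dC : 'C(d + 2, d.+1) = (d + 2)%N by rewrite addn2 binSn.
by rewrite addSn binS dC addnC addnA.
Qed.

Lemma dim3E d : (2 * 'C(d + 2, d) = (d + 1) * (d + 2))%N.
Proof. by elim: d => // d IHd; rewrite dim3S; lia. Qed.

(** Here [h] is the Hilbert function of [s] points and [al] the least degree of a curve through
    them. Increments are at least 3 below [al] because all forms count there, and from [al] on
    because concavity propagates the last increment downwards. *)
Lemma concave_growth (h : nat -> nat) (m s al : nat) :
    (3 <= al)%N -> (al <= m)%N ->
    (forall d, (d < al)%N -> h d = 'C(d + 2, d)) ->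
    (forall d, (al <= d.+2)%N -> (h d.+2 + h d <= 2 * h d.+1)%N) ->
    (s <= (h m).+1)%N -> (h m.-1 + 3 <= s)%N -> (h m.-2 + 6 <= s)%N ->
    (s <= 3 * m)%N ->
  s = (3 * m)%N /\ al = 3%N.
Proof.
move=> al3; case: m => [|[|m]] alm;
  [by lia | by lia | move=> /= hD conc hm hm1 hm2 sm].
(* Now [m] is two less than in the statement. An increment of at most 2 would, by concavity and
   [hm], force [h m] to be at least [s - 5], against [hm2]. *)
have last : (h m + 3 <= h m.+1)%N by have := conc m alm; lia.
have high k : (k <= m)%N -> (al <= (m - k).+2)%N ->
    (h (m - k) + 3 <= h (m - k).+1)%N.
  elim: k => [|k IHk] km alk; first by rewrite subn0.
  have mk : (m - k = (m - k.+1).+1)%N by lia.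
  rewrite mk in IHk; have := IHk (ltnW km); have := conc _ alk; lia.
have step d : (1 <= d)%N -> (d <= m)%N -> (h d + 3 <= h d.+1)%N.
  move=> d1 dm; case: (leqP al d.+1) => ald.
    by have := high (m - d)%N; rewrite subKn // leq_subr; apply=> //; lia.
  by rewrite !hD ?dim3S //; [lia | apply: ltnW].
have grow d0 k : (1 <= d0)%N -> (d0 + k <= m.+1)%N ->
    (h d0 + 3 * k <= h (d0 + k))%N.
  move=> d01; elim: k => [|k IHk] km; first by rewrite muln0 !addn0.
  have s1 : (h (d0 + k) + 3 <= h (d0 + k).+1)%N by apply: step; lia.
  have : (h d0 + 3 * k <= h (d0 + k))%N by apply: IHk; lia.
  by rewrite addnS; lia.
have h1 : h 1 = 3%N by rewrite hD //; lia.
have := grow 1%N m isT (leqnn _); rewrite h1 add1n => low.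
split; first by lia.
(* If [al] were larger, growth would start from 10 in degree 3 instead of 9, and one point too many
   would result. *)
apply/eqP; rewrite eqn_leq al3 andbT leqNgt; apply/negP=> al4.
have h3 : h 3 = 10%N by rewrite hD.
have := grow 3%N (m - 2)%N isT; rewrite h3 (_ : 3 + (m - 2) = m.+1)%N;
  last by lia.
by move=> /(_ (leqnn _)); lia.
Qed.

Lemma homog1_linform (F : fieldType) b (f : {mpoly F[b]}) :
  f \is 1.-homog -> exists a, f = linform a.
Proof.
move: f; apply: homog_ind => [|f1 f2 [a1 ->] [a2 ->]|f0 j /homog0_const ->].
- by exists 0; rewrite /linform big1 // => j _; rewrite mxE scale0r.
- exists (a1 + a2); rewrite /linform -big_split; apply: eq_bigr => j _.
  by rewrite mxE scalerDl.
- exists ((f0@_0) *: delta_mx j 0); rewrite mul_mpolyC /linform (bigD1 j) //=.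
  rewrite !mxE !eqxx mulr1 big1 ?addr0 // => i iNj.
  by rewrite !mxE (negPf iNj) mulr0 scale0r.
Qed.

Lemma linform_through (F : fieldType) b r (L : 'M[F]_(r, b)) : (r < b)%N ->
  exists2 a : 'cV[F]_b, linform a != 0 &
    forall x : 'rV_b, (x <= L)%MS -> evalv x (linform a) = 0.
Proof.
move=> rb; have /row_subPn[k kL] : ~~ ((1%:M : 'M_b) <= L)%MS.
  apply/negP=> /mxrankS; rewrite mxrank1 leqNgt => /negP; apply.
  exact: leq_ltn_trans (rank_leq_row L) rb.
have [a La aN0] := linform_separate kL; exists a.
  apply: contraNneq aN0 => a0; rewrite -evalv_linform a0.
  by rewrite /evalv meval0.
by move=> x xL; rewrite evalv_linform (sub_linform0 La xL) mxE.
Qed.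

(* Factors of a form may thus be replaced by forms. *)
Lemma top_homog (F : fieldType) b d (f q h : {mpoly F[b]}) :
    f != 0 -> f \is d.-homog -> f = q * h ->
  d = ((msize q).-1 + (msize h).-1)%N /\
  f = pihomog mdeg (msize q).-1 q * pihomog mdeg (msize h).-1 h.
Proof.
move=> fN0 hf fE; have : q * h != 0 by rewrite -fE.
rewrite mulf_eq0 negb_or => /andP[qN0 hN0].
have q_gt0 : msize q = (msize q).-1.+1 by rewrite -mpolySpred.
have h_gt0 : msize h = (msize h).-1.+1 by rewrite -mpolySpred.
set i0 := (msize q).-1 in q_gt0 *; set j0 := (msize h).-1 in h_gt0 *.
have dE : d = (i0 + j0)%N.
  apply: (dhomog_uniq fN0 hf); have := dhomog_msize hf.
  by rewrite fE msizeM // q_gt0 h_gt0 addnS addSn.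
split=> //; rewrite -{1}(pihomog_dE hf) fE.
have qE : q = \sum_(i < i0.+1) pihomog mdeg i q.
  by apply: pihomog_partitionE; rewrite -q_gt0.
have hE : h = \sum_(j < j0.+1) pihomog mdeg j h.
  by apply: pihomog_partitionE; rewrite -h_gt0.
(* For degree reasons only the product of the two top components contributes in degree [d]. *)
rewrite {1}qE {1}hE big_distrlr /= raddf_sum (bigD1 ord_max) //= raddf_sum.
rewrite (bigD1 ord_max) //= [X in _ + X + _]big1 => [|j jN].
  rewrite [X in _ + X]big1 => [|i iN].
    by rewrite !addr0 dE pihomog_dE // dhomogM // pihomogP.
  rewrite raddf_sum big1 // => j _; apply: (pihomog_ne0 (d := (i + j)%N)).
    have := ltn_ord j; have : (i < i0)%N.
      by rewrite ltn_neqAle -ltnS ltn_ord andbT; apply: contra iN => /eqP iE;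
        apply/eqP/val_inj.
    by rewrite dE ltnS; lia.
  by apply: dhomogM; apply: pihomogP.
apply: (pihomog_ne0 (d := (i0 + j)%N)); last by apply: dhomogM; apply: pihomogP.
have : (j < j0)%N.
  by rewrite ltn_neqAle -ltnS ltn_ord andbT; apply: contra jN => /eqP jE;
    apply/eqP/val_inj.
by rewrite dE; lia.
Qed.

(** * Bezout-type counts for lines and conics *)

Section PlanarBezout.

Variables (F : fieldType) (n : nat) (u : 'I_n -> 'rV[F]_3) (S : {set 'I_n}).
Hypothesis u_neq0 : forall i, i \in S -> u i != 0.
Hypothesis u_inj : {in S &, forall i j, (u i <= u j)%MS -> i = j}.

Definition zeros (f : {mpoly F[3]}) : {set 'I_n} :=
  [set i in S | evalv (u i) f == 0].

Lemma subset_of_card (T : {set 'I_n}) k : (k <= #|T|)%N ->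
  exists2 T' : {set 'I_n}, T' \subset T & #|T'| = k.
Proof.
case/card_geqP=> s [us <- sT]; exists [set x in s].
  by apply/subsetP=> x; rewrite inE => /sT.
by rewrite cardsE; apply/card_uniqP.
Qed.

(* Few points which impose dependent conditions lie on a line, so the points
   on a curve q = 0 either impose enough conditions to force q to divide g or
   accumulate on a line. *)
Lemma line_bezout d (l g : {mpoly F[3]}) (T : {set 'I_n}) :
    l != 0 -> l \is 1.-homog -> g \is d.+1.-homog -> T \subset S ->
    {in T, forall i, evalv (u i) l = 0} ->
    {in T, forall i, evalv (u i) g = 0} ->
    (d + 2 <= #|T|)%N ->
  exists2 h, h \is d.-homog & g = l * h.
Proof.
move=> lN0 hl hg TS l0 g0 /subset_of_card[T' T'T cardT'].
have sub i : i \in T' -> i \in T := subsetP T'T i.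
(* A relation in degree [d.+1] needs [d + 3] points, one more than [T'] has; and [d + 2] is the
   codimension of the multiples of [l]. *)
have dim : rk u T' d.+1 = (d + 2)%N.
  apply/eqP; rewrite -cardT' eqn_leq rk_le_card leqNgt.
  apply/negP=> /rk_lt_card[c [dc cT c0]].
  have := card_supp_dep u_neq0 u_inj dc (subset_trans cT (subset_trans T'T TS))
    c0.
  have := subset_leq_card cT; rewrite cardT'; lia.
rewrite -[d.+1]addn1 in hg dim.
apply: (vanishing_multiple lN0 hl (T := T') (u := u)) => //.
- by move=> i /sub; apply: l0.
- by move=> i /sub; apply: g0.
- by rewrite dim addn1 dim3S; lia.
Qed.

(** The bound [2 * d + 5] is the codimension of the multiples of [q] in degree [d.+2], and also the
    largest size for which [dep_collinear] applies in that degree. A relation on that many points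
    thus has a collinear support of at least [d + 4] points. *)
Lemma conic_bezout d (q g : {mpoly F[3]}) (T : {set 'I_n}) :
    q != 0 -> q \is 2.-homog -> g \is d.+2.-homog -> T \subset S ->
    {in T, forall i, evalv (u i) q = 0} ->
    {in T, forall i, evalv (u i) g = 0} ->
    (2 * d + 5 <= #|T|)%N ->
  (exists2 h, h \is d.-homog & g = q * h) \/
  (exists l, [/\ l != 0, l \is 1.-homog &
     (d + 4 <= #|[set i in T | evalv (u i) l == 0%R]|)%N]).
Proof.
move=> qN0 hq hg TS q0 g0 /subset_of_card[T' T'T cardT'].
have sub i : i \in T' -> i \in T := subsetP T'T i.
have := rk_le_card u T' d.+2; rewrite leq_eqVlt => /orP[/eqP dim|]; last first.
  move/rk_lt_card=> [c [dc cT c0]].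
  have cS := subset_trans cT (subset_trans T'T TS).
  have [|L LP] := dep_collinear u_neq0 u_inj dc cS.
    by have := subset_leq_card cT; rewrite cardT'; clear; lia.
  have [a aN0 aL] := linform_through L isT.
  right; exists (linform a); split; rewrite ?linform_homog //.
  have := card_supp_dep u_neq0 u_inj dc cS c0.
  rewrite (_ : d.+2 + 2 = d + 4)%N; last by rewrite !addSnnS.
  move/leq_trans; apply; apply: subset_leq_card.
  apply/subsetP=> i ic; rewrite inE aL ?LP // eqxx andbT.
  by apply: sub; apply: (subsetP cT).
left; rewrite -[d.+2]addn2 in hg dim.
apply: (vanishing_multiple qN0 hq (T := T') (u := u)) => //.
- by move=> i /sub; apply: q0.
- by move=> i /sub; apply: g0.
- by rewrite dim cardT' [in 'C(_ + 2 + 2, _)](addn2 d) !dim3S; lia.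
Qed.

End PlanarBezout.

(** * Minimal relations without large collinear or conic subsets *)

Section PlanarCircuit.

Variables (K : closedFieldType) (n : nat) (u : 'I_n -> 'rV[K]_3).
Variable S : {set 'I_n}.
Variables (c : 'I_n -> K) (m : nat).
Hypothesis u_neq0 : forall i, i \in S -> u i != 0.
Hypothesis u_inj : {in S &, forall i j, (u i <= u j)%MS -> i = j}.
Hypothesis m_ge2 : (2 <= m)%N.
Hypothesis dep_c : dep u m c.
Hypothesis supp_c : supp c = S.
Hypothesis S_gt0 : (0 < #|S|)%N.
Hypothesis S_min : forall c', dep u m c' -> supp c' \subset S ->
  (0 < #|supp c'|)%N -> (#|S| <= #|supp c'|)%N.
Hypothesis S_le : (#|S| <= 3 * m)%N.
Hypothesis no_line : forall l : {mpoly K[3]}, l != 0 -> l \is 1.-homog ->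
  (#|zeros u S l| <= m + 1)%N.
Hypothesis no_conic : forall q : {mpoly K[3]}, q != 0 -> q \is 2.-homog ->
  (#|zeros u S q| <= 2 * m + 1)%N.

(** With fewer points [S] would be collinear, and it has at least [m + 2] points. *)
Lemma circuit_card_ge : (2 * m + 2 <= #|S|)%N.
Proof.
have cS : supp c \subset S by rewrite supp_c.
rewrite addn2 -addn1 ltnNge; apply/negP=> S_small.
have [|L LP] := dep_collinear u_neq0 u_inj dep_c cS; first by rewrite supp_c.
have [a aN0 aL] := linform_through L isT.
have := no_line aN0 (linform_homog a).
have -> : zeros u S (linform a) = S.
  by apply/setP=> i; rewrite inE; case: (boolP (i \in S)) => //= iS;
    rewrite aL ?eqxx ?LP ?supp_c.
have := card_supp_dep u_neq0 u_inj dep_c cS; rewrite supp_c => /(_ S_gt0).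
by clear; lia.
Qed.

Lemma zeros_all (f : {mpoly K[3]}) :
  {in S, forall i, evalv (u i) f = 0} -> zeros u S f = S.
Proof.
move=> f0; apply/setP=> i; rewrite inE.
by case: (boolP (i \in S)) => //= iS; rewrite f0 ?eqxx.
Qed.

(** A form of degree at most 2 through [S], multiplied by a power of a coordinate, would give a
    conic through all of [S], which has more than [2 * m + 1] points. *)
Lemma rk_small e : (e <= 2)%N -> rk u S e = 'C(e + 2, e).
Proof.
move=> e2; apply/eqP; rewrite eqn_leq rk_le_dim leqNgt.
apply/negP=> /vanishing_form[f [fN0 hf f0]].
pose x0 : 'cV[K]_3 := delta_mx ord0 0; pose q := f * linform x0 ^+ (2 - e).
have qN0 : q != 0.
  by rewrite mulf_neq0 // expf_neq0 // linform_delta -msupp_eq0 msuppX.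
have hq : q \is 2.-homog.
  by have := dhomogM hf (dhomogXn (2 - e) (linform_homog x0));
    rewrite muln1 subnKC.
have := no_conic qN0 hq; rewrite zeros_all; last first.
  by move=> i iS; rewrite evalvM f0 ?mul0r.
by have := circuit_card_ge; clear; lia.
Qed.

Lemma circuit_rk_pairing e : (e <= m)%N ->
  (rk u S (m - e) + rk u S e <= #|S|)%N.
Proof. by move=> em; apply: (rk_pairing (c := c)); rewrite // subnK. Qed.

Lemma circuit_cubic : [/\ (3 <= m)%N, #|S| = (3 * m)%N &
  exists f : {mpoly K[3]},
    [/\ f != 0, f \is 3.-homog & {in S, forall i, evalv (u i) f = 0}]].
Proof.
have rk_m : (rk u S m < #|S|)%N.
  by apply/rk_lt_card; exists c; rewrite supp_c.
have m_ge3 : (3 <= m)%N.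
  (* For [m = 2] the rank would be 6, leaving no room for a relation on at most 6 points. *)
  rewrite ltn_neqAle m_ge2 andbT; apply/eqP=> m2.
  by move: rk_m S_le; rewrite -m2 rk_small //;
    rewrite (_ : 'C(2 + 2, 2) = 6) //; clear; lia.
have small_m : (rk u S m < 'C(m + 2, m))%N.
  by have := dim3E m; move: rk_m S_le m_ge3; clear; nia.
have exal : exists al, (rk u S al < 'C(al + 2, al))%N by exists m.
case: (ex_minnP exal) => al lt_al min_al.
have [f [fN0 hf f0]] := vanishing_form lt_al.
have al3 : (3 <= al)%N.
  by rewrite ltnNge; apply/negP=> /rk_small rkE; rewrite rkE ltnn in lt_al.
have alm : (al <= m)%N by apply: min_al.
have [Sm al_eq] : #|S| = (3 * m)%N /\ al = 3%N.
  apply: (@concave_growth (rk u S)) => //.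
  - move=> d d_al; apply/eqP; rewrite eqn_leq rk_le_dim leqNgt.
    by apply: contraL d_al => /min_al; rewrite -leqNgt.
  - case: al al3 hf {lt_al min_al alm} => // e _ hf' d le_ed.
    exact: (rk_concave u_neq0 fN0 hf' f0 le_ed).
  - exact: rk_circuit.
  - by have := circuit_rk_pairing (ltnW m_ge2);
    rewrite (rk_small (e := 1)) // subn1.
  - by have := circuit_rk_pairing m_ge2; rewrite (rk_small (e := 2)) // subn2.
by split=> //; exists f; rewrite al_eq in hf.
Qed.

Lemma card_off_zeros (h : {mpoly K[3]}) k : (#|zeros u S h| <= k)%N ->
  (#|S| - k <= #|S :\: zeros u S h|)%N.
Proof.
rewrite leq_subLR -(cardsID (zeros u S h) S) => le_k.
rewrite leq_add2r; apply: leq_trans le_k; apply: subset_leq_card.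
exact: subsetIr.
Qed.

Lemma vanish_off_zeros (h q : {mpoly K[3]}) :
  {in S, forall i, evalv (u i) (q * h) = 0} ->
  {in S :\: zeros u S h, forall i, evalv (u i) q = 0}.
Proof.
move=> qh0 i; rewrite !inE => /andP[+ iS]; rewrite iS /= => hN0.
by have /eqP := qh0 i iS; rewrite evalvM mulf_eq0 (negPf hN0) orbF => /eqP.
Qed.

(* If the cubic f and the form g through S share a factor, removing it and
   applying Bezout to the remaining points shows that f divides g. *)
Lemma cubic_divides (f g h q q' : {mpoly K[3]}) e e' :
    (3 <= m)%N -> #|S| = (3 * m)%N ->
    f != 0 -> {in S, forall i, evalv (u i) f = 0} ->
    {in S, forall i, evalv (u i) g = 0} -> (0 < e)%N -> (e + e' = 3)%N ->
    h \is e.-homog -> q \is e'.-homog -> f = q * h ->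
    q' \is (m - e).-homog -> g = q' * h ->
  exists2 k, k \is (m - 3).-homog & g = f * k.
Proof.
move=> m_ge3 cardS fN0 f0 g0 e_gt0 ee' hh hq fE hq' gE.
have : q * h != 0 by rewrite -fE.
rewrite mulf_eq0 negb_or => /andP[qN0 hN0].
have TS (r : {mpoly K[3]}) : S :\: zeros u S r \subset S := subsetDl _ _.
have q0 : {in S :\: zeros u S h, forall i, evalv (u i) q = 0}.
  by apply: vanish_off_zeros; rewrite -fE.
have q'0 : {in S :\: zeros u S h, forall i, evalv (u i) q' = 0}.
  by apply: vanish_off_zeros; rewrite -gE.
case: e e_gt0 ee' hh hq' => [//|[|[|[|e]]]] _ ee' hh hq'; last by [].
(* Here [h] is a line and [q] a conic. Off [h] there remain at least [2 * m - 1] points, exactly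
   what [conic_bezout] needs for [d = m - 3]. *)
- have e'E : e' = 2%N by lia.
  rewrite {}e'E {ee'} in hq.
  have cardT := card_off_zeros (no_line hN0 hh).
  have mE : (m - 1 = (m - 3).+2)%N by lia.
  rewrite mE in hq'.
  have [|[k hk kE]|[l [lN0 hl l_ge]]] := conic_bezout u_neq0 u_inj qN0 hq hq'
    (TS h) q0 q'0.
  + by move: cardT; rewrite cardS; move: m_ge3; clear; lia.
  + by exists k => //; rewrite fE gE kE; ring.
  (* Otherwise a line [l] carries at least [m + 1] of these points, hence divides both [q] and [q'].
     The conic [h * l] leaves at least [m - 1] points, all on the last line [l2], which then divides
     the remaining factor [k1]. *)
  pose Z := [set i in S :\: zeros u S h | evalv (u i) l == 0].
  have ZT i : i \in Z -> i \in S :\: zeros u S h by rewrite inE => /andP[].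
  have ZS : Z \subset S by apply/subsetP=> i /ZT; apply: (subsetP (TS h)).
  have l0 : {in Z, forall i, evalv (u i) l = 0}.
    by move=> i; rewrite inE => /andP[_ /eqP].
  have [||l2 hl2 qE] := line_bezout u_neq0 u_inj lN0 hl hq ZS l0 _.
  + by move=> i /ZT; apply: q0.
  + by move: l_ge; rewrite -/Z; clear; lia.
  have [||k1 hk1 q'E] := line_bezout u_neq0 u_inj lN0 hl hq' ZS l0 _.
  + by move=> i /ZT; apply: q'0.
  + by move: l_ge; rewrite -/Z; clear; lia.
  have hhl : h * l \is 2.-homog by rewrite (dhomogM hh hl).
  have hlN0 : h * l != 0 by rewrite mulf_neq0.
  have l2N0 : l2 != 0 by apply: contraNneq qN0 => l20; rewrite qE l20 mulr0.
  have k1_homog : k1 \is (m - 3).+1.-homog by [].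
  have [|||k hk k1E] := line_bezout u_neq0 u_inj l2N0 hl2 k1_homog (TS (h * l)).
  + by apply: vanish_off_zeros => i iS; rewrite -(f0 i iS) fE qE; congr evalv;
    ring.
  + by apply: vanish_off_zeros => i iS; rewrite -(g0 i iS) gE q'E; congr evalv;
    ring.
  + by have := card_off_zeros (no_conic hlN0 hhl); rewrite cardS; move: m_ge3;
    clear; lia.
  by exists k => //; rewrite fE gE q'E qE k1E; ring.
(* Here [h] is a conic, and at least [m - 1] points remain on the line [q]. *)
- have e'E : e' = 1%N by lia.
  rewrite {}e'E {ee'} in hq.
  have mE : (m - 2 = (m - 3).+1)%N by lia.
  rewrite mE in hq'.
  have [|k hk q'E] := line_bezout u_neq0 u_inj qN0 hq hq' (TS h) q0 q'0.
    by have := card_off_zeros (no_conic hN0 hh); rewrite cardS; move: m_ge3;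
      clear; lia.
  by exists k => //; rewrite fE gE q'E; ring.
- have e'E : e' = 0%N by lia.
  rewrite {}e'E {ee'} in hq; have qC := homog0_const hq.
  have CN0 : q@_0 != 0 by apply: contraNneq qN0 => C0; rewrite qC C0 mpolyC0.
  exists ((q@_0)^-1 *: q'); first exact: rpredZ.
  have hE : (q@_0)^-1 *: q = 1 by rewrite {2}qC -mul_mpolyC -mpolyCM mulVf.
  by rewrite gE fE -scalerAr !scalerAl hE mul1r mulrC.
Qed.

Lemma circuit_complete_intersection : #|S| = (3 * m)%N /\
  exists f g : {mpoly K[3]},
    [/\ plane_form 3 f, plane_form m g, ~ common_component f g &
        {in S, forall i, evalv (u i) f = 0 /\ evalv (u i) g = 0}].
Proof.
have [m_ge3 cardS [f [fN0 hf f0]]] := circuit_cubic; split=> //.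
have mE : (m - 3 + 3)%N = m by rewrite subnK.
have rk_m : (rk u S m < #|S|)%N.
  by apply/rk_lt_card; exists c; rewrite supp_c.
have [g [hg g0 gNf]] : exists g, [/\ g \is m.-homog,
    {in S, forall i, evalv (u i) g = 0} &
    ~ exists2 h, h \is (m - 3).-homog & g = f * h].
  (* The multiples of [f] have codimension [3 * m] in degree [m], whereas [S] imposes at most
     [3 * m - 1] conditions. *)
  have := exists_nonmultiple (T := S) (u := u) (d := m - 3) fN0 hf.
  rewrite mE; apply; have := dim3E m; have := dim3E (m - 3).
  by move: rk_m; rewrite cardS; move: m_ge3; clear; nia.
have gN0 : g != 0.
  by apply/eqP=> g_eq0; apply: gNf; exists 0; rewrite ?rpred0 // mulr0.
exists f, g; split=> //; last by move=> i iS; rewrite f0 ?g0.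
case=> h [[hN0 h_nonunit _] [q fE] [q' gE]]; apply: gNf.
have [eq3 fE'] := top_homog fN0 hf fE; have [eqm gE'] := top_homog gN0 hg gE.
have e_gt0 : (0 < (msize h).-1)%N.
  rewrite lt0n; apply: contra h_nonunit => /eqP h1.
  have : (msize h <= 1)%N by case: (msize h) h1 => [|[]].
  move/msize1_polyC=> hC; rewrite hC in hN0 *.
  by apply: rmorph_unit; rewrite unitfE; apply: contraNneq hN0 => ->;
    rewrite mpolyC0.
have deg : (m - (msize h).-1)%N = (msize q').-1 by rewrite {1}eqm addnK.
apply: (cubic_divides (e' := (msize q).-1) m_ge3 cardS fN0 f0 g0 e_gt0 _ _ _
  fE' _ gE').
- by rewrite addnC -eq3.
- exact: pihomogP.
- exact: pihomogP.
- by rewrite deg pihomogP.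
Qed.

End PlanarCircuit.

(** * Extension of scalars *)

Lemma dep_pullback (F : fieldType) a b n (p : 'I_n -> 'rV[F]_a)
    (u : 'I_n -> 'rV[F]_b) (A : 'M[F]_(b, a)) d c :
  (forall i, i \in supp c -> p i = u i *m A) -> dep u d c -> dep p d c.
Proof.
move=> pE dc f /(form_pullback A)[g hg gE]; rewrite -[RHS](dc g hg).
apply: eq_bigr => i _; case: (boolP (i \in supp c)) => [ic|].
  by rewrite gE -pE.
by rewrite inE negbK => /eqP->; rewrite !mul0r.
Qed.

Lemma thin_matrix (F : fieldType) a b r (X : 'M[F]_(a, b)) :
  (\rank X <= r)%N -> exists Y : 'M[F]_(r, b), (X <= Y)%MS.
Proof.
move=> Xr; exists (pid_mx (\rank X) *m row_ebase X).
rewrite -{1}(mulmx_ebase X) -(@pid_mx_id F a r b _ Xr) -!mulmxA.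
exact: submx_trans (submxMl _ _) (submxMl _ _).
Qed.

Section FieldExtension.

Variables (k K : fieldType) (iota : {rmorphism k -> K}) (N n : nat).
Variable P : 'I_n -> 'rV[k]_N.+1.

Local Notation p := (fun i => map_mx iota (P i)).

Lemma evalv_map (x : 'rV[k]_N.+1) (f : {mpoly k[N.+1]}) :
  evalv (map_mx iota x) (map_mpoly iota f) = iota (evalv x f).
Proof.
elim/mpolyind: f => [|e mo f _ _ IHf].
  by rewrite /evalv !raddf0.
rewrite raddfD /= !evalvD rmorphD IHf; congr (_ + _).
rewrite map_mpolyZ map_mpolyX !evalvZ rmorphM /evalv !mevalX rmorph_prod;
  congr (_ * _).
by apply: eq_bigr => j _; rewrite rmorphXn mxE.
Qed.

(** By linearity it suffices to test monomials, whose values at the points already lie in [k]. *)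
Lemma dep_map d (c : 'I_n -> k) : dep P d c -> dep p d (iota \o c).
Proof.
move=> dc f /dhomogP hf.
under eq_bigr => i _ do rewrite /evalv mevalE mulr_sumr.
rewrite exchange_big big_seq big1 //= => mo /hf deg_mo.
transitivity (f@_mo * iota (\sum_i c i * evalv (P i) 'X_[mo])).
  rewrite rmorph_sum mulr_sumr; apply: eq_bigr => i _.
  rewrite rmorphM /evalv mevalX rmorph_prod mulrCA; congr (_ * (_ * _)).
  by apply: eq_bigr => j _; rewrite mxE rmorphXn.
by rewrite dc ?rmorph0 ?mulr0 // dhomogX; apply/eqP.
Qed.

(** Forms over [k] that take the value 1 at one point of [T] and 0 at the others keep this property
    over [K]. *)
Lemma rk_map T d : rk P T d = #|T| -> rk p T d = #|T|.
Proof.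
move=> full; apply/eqP; rewrite eqn_leq rk_le_card.
rewrite -[leqLHS](mxrank1 K); apply: mxrankS; apply/row_subP=> j; rewrite row1.
have : ((delta_mx 0 j : 'rV[k]_#|T|) <= evmx P T d)%MS.
  by apply: submx_full; rewrite /row_full -/(rk P T d) full.
case/submxP=> v; rewrite mul_evmx; set f := r2v _ => fE.
have hf : map_mpoly iota (mpoly_of_dhomog f) \is d.-homog.
  apply/dhomogP=> mo; rewrite mcoeff_msupp mcoeff_map_mpoly fmorph_eq0.
  by rewrite -mcoeff_msupp; apply: (dhomogP _ _ _ (dhomog_is_dhomog f)).
have := evrow_sub p T (DHomog hf); congr (_ <= _)%MS.
apply/rowP=> j'; rewrite mxE evalv_map.
by have /rowP/(_ j') := fE; rewrite !mxE => <-; rewrite rmorph_nat.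
Qed.

Lemma lead_index_neq0 (x : 'rV[k]_N.+1) : x != 0 -> x 0 (lead_index x) != 0.
Proof.
case/rV0Pn=> i xi; rewrite /lead_index; case: pickP => [j /andP[]//|none].
pose j := [arg min_(j < i | x 0 j != 0) (j : nat)].
have [jN0 j_min] : x 0 j != 0 /\ forall l, x 0 l != 0 -> (j <= l)%N.
  by rewrite /j; case: arg_minnP.
have /negP[] := none j; rewrite jN0; apply/forallP=> l; apply/implyP=> lj.
by apply: contraTT lj => /j_min; rewrite -leqNgt.
Qed.

Hypothesis P_neq0 : forall i, P i != 0.

(** The maps [ev] differ from plain evaluation by the nonzero factors [w i], so relations correspond
    by rescaling their coefficients. *)
Lemma linked_rk m (S : {set 'I_n}) : linked m P S <-> (rk P S m < #|S|)%N.
Proof.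
rewrite /linked /general_position.
pose X := map_tuple (fun i => ev m (P i)) (enum_tuple S).
have XE (j : 'I_#|S|) : X`_j = ev m (P (enum_val j)).
  have i0 : 'I_n := enum_val j.
  by rewrite (nth_map i0) ?size_tuple ?ltn_ord // -(enum_val_nth i0).
pose w i := P i 0 (lead_index (P i)) ^+ m.
have wN0 i : w i != 0 by rewrite expf_neq0 // lead_index_neq0.
have evE i (f : dhomog N.+1 k m) : ev m (P i) f = evalv (P i) f / w i.
  by rewrite lfunE.
rewrite (_ : [seq _ | _ <- _] = X) //; split.
  move=> notfree; apply/rk_lt_card; apply: NNPP => indep.
  case/negP: notfree; apply/freeP=> q q0 j; apply: NNPP => /eqP qj.
  apply: indep; pose c i := \sum_(j < #|S| | enum_val j == i) q j / w i.
  have cE j' : c (enum_val j') = q j' / w (enum_val j').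
    rewrite /c (eq_bigl (pred1 j')) ?big_pred1_eq // => j''.
    exact: (inj_eq enum_val_inj).
  have cS : supp c \subset S.
    apply/subsetP=> i; rewrite inE; apply: contraNT => iS; apply/eqP.
    by apply: big1 => j' /eqP ji; rewrite -ji enum_valP in iS.
  exists c; split=> //; last first.
    by apply/card_gt0P; exists (enum_val j);
      rewrite inE cE mulf_neq0 ?invr_neq0.
  move=> f hf; rewrite (sum_enum_val _ cS).
  have /lfunP/(_ (DHomog hf)) := q0; rewrite sum_lfunE lfunE /= => E0.
  rewrite -[RHS]E0; apply: eq_bigr => j' _; rewrite XE scale_lfunE evE cE /=.
  by rewrite /GRing.scale /= mulrAC mulrA.
case/rk_lt_card=> c [dc cS /card_gt0P[i ic]]; apply/negP=> /freeP free.
have iS := subsetP cS _ ic.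
have := free (fun j => c (enum_val j) * w (enum_val j)) _ (enum_rank_in iS i).
rewrite enum_rankK_in // => H.
have /eqP : c i * w i = 0.
  apply: H; apply/lfunP=> f; rewrite sum_lfunE lfunE /=.
  have := dc _ (dhomog_is_dhomog f); rewrite (sum_enum_val _ cS) => E0.
  rewrite -[RHS]E0; apply: eq_bigr => j' _; rewrite XE scale_lfunE evE /=.
  by rewrite /GRing.scale /= -mulrA; congr (_ * _); rewrite mulrC divfK.
by rewrite mulf_eq0 (negPf (wN0 i)) orbF; rewrite inE in ic; rewrite (negPf ic).
Qed.

(** Being linked is insensitive to extending the field, so the geometric arguments can be carried
    out over [K]. *)
Lemma linked_dep m (S : {set 'I_n}) : linked m P S <->
  exists c : 'I_n -> K, [/\ dep p m c, supp c \subset S & (0 < #|supp c|)%N].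
Proof.
rewrite linked_rk; split.
  case/rk_lt_card=> c [dc cS c0]; exists (iota \o c).
  have -> : supp (iota \o c) = supp c.
    by apply/setP=> i; rewrite !inE fmorph_eq0.
  by split=> //; apply: dep_map.
move/rk_lt_card=> lt_rk; rewrite ltn_neqAle rk_le_card andbT.
by apply: contraL lt_rk => /eqP/rk_map ->; rewrite ltnn.
Qed.

End FieldExtension.

Lemma min_linkedP (F : fieldType) N n m (P : 'I_n -> 'rV[F]_N.+1) :
  match min_linked m P with
  | Some t => (exists2 S, linked m P S & #|S| = t) /\
              forall S, linked m P S -> (t <= #|S|)%N
  | None => forall S, ~ linked m P S
  end.
Proof.
rewrite /min_linked; case: pickP => [S0 linkedS0|none S]; last by rewrite none.
by case: arg_minnP => // S linkedS minS; split=> //; exists S.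
Qed.

Lemma irreducible_factor (F : fieldType) (f : {mpoly F[3]}) :
  f != 0 -> f \isn't a GRing.unit ->
  exists2 h, irreducible_mpoly h & exists q, f = q * h.
Proof.
have [s] := ubnP (msize f); elim: s f => // s IHs f lt_s fN0 f_nonunit.
have [irr|red] := classic (irreducible_mpoly f).
  by exists f => //; exists 1; rewrite mul1r.
have [a [b [fE a_nonunit b_nonunit]]] : exists a b, [/\ f = a * b,
    a \isn't a GRing.unit & b \isn't a GRing.unit].
  apply: NNPP => none; apply: red; split=> // a b fE.
  apply: NNPP => /not_or_and[/negP a_nonunit /negP b_nonunit].
  by apply: none; exists a, b.
have : a * b != 0 by rewrite -fE.
rewrite mulf_eq0 negb_or => /andP[aN0 bN0].
have [|h irr [q bE]] := IHs b _ bN0 b_nonunit; last first.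
  by exists h => //; exists (a * q); rewrite fE bE mulrA.
have : (1 < msize a)%N.
  rewrite ltnNge; apply: contra a_nonunit => /msize1_polyC aC.
  rewrite aC in aN0 *; apply: rmorph_unit; rewrite unitfE.
  by apply: contraNneq aN0 => ->; rewrite mpolyC0.
by move: lt_s; rewrite fE msizeM //; move: (msize a) (msize b) => x y; clear;
  lia.
Qed.

Lemma homog_nonunit (F : fieldType) b d (f : {mpoly F[b]}) :
  f != 0 -> f \is d.+1.-homog -> f \isn't a GRing.unit.
Proof.
move=> fN0 hf; apply/negP=> /unitrPr[g fg1].
have gN0 : g != 0.
  by apply/eqP=> g0; move/eqP: fg1; rewrite g0 mulr0 eq_sym oner_eq0.
have dE : d.+1 = (msize f).-1 := dhomog_uniq fN0 hf (dhomog_msize hf).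
have := congr1 (@mmeasure b F mdeg) fg1; rewrite msizeM // msize1.
have : (0 < msize g)%N by rewrite lt0n msize_poly_eq0.
by move: dE; move: (msize f) (msize g) => x y; clear; lia.
Qed.

(** * Linked points and plane curves *)

Section Points.

Variables (k : fieldType) (K : closedFieldType) (iota : {rmorphism k -> K}).
Variables (N n : nat) (P : 'I_n -> 'rV[k]_N.+1).
Hypothesis P_distinct : distinct_points P.
Variable m : nat.
Hypothesis m_ge2 : (2 <= m)%N.

Local Notation p := (fun i => map_mx iota (P i)).

Let P_neq0 : forall i, P i != 0 := P_distinct.1.

Lemma P_inj (S : {set 'I_n}) : {in S &, forall i j, (P i <= P j)%MS -> i = j}.
Proof.
move=> i j _ _ sij; apply: P_distinct.2; rewrite sij /=.
by rewrite -(mxrank_leqif_sup sij) !rank_rV !P_neq0.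
Qed.

Lemma p_neq0 (S : {set 'I_n}) : forall i, i \in S -> p i != 0.
Proof. by move=> i _; rewrite map_mx_eq0. Qed.

Lemma p_inj (S : {set 'I_n}) : {in S &, forall i j, (p i <= p j)%MS -> i = j}.
Proof. by move=> i j iS jS; rewrite map_submx; apply: P_inj iS jS. Qed.

(** Binary forms of degree [m] have dimension [m + 1], too small for [m + 2] independent
    conditions. *)
Lemma linked_of_collinear (T : {set 'I_n}) :
  #|T| = (m + 2)%N -> collinear P T -> linked m P T.
Proof.
move=> cardT [L freeL TL]; apply/(linked_rk P_neq0).
pose w i := P i *m pinvmx L.
have : (rk w T m < #|T|)%N.
  by have := rk_le_dim w T m; rewrite cardT addn1 binSn; clear; lia.
case/rk_lt_card=> c [dc cT c0]; apply/rk_lt_card; exists c; split=> //.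
apply: (dep_pullback (A := L)) dc => i ic.
by rewrite /w mulmxKpV // TL // (subsetP cT).
Qed.

Lemma plane_coordinates (A : 'M[K]_(3, N.+1)) (f : {mpoly K[3]})
    (T : {set 'I_n}) :
    row_free A -> (forall i, i \in T -> on_plane_curve A f (p i)) ->
  forall i, i \in T ->
    p i = (p i *m pinvmx A) *m A /\ evalv (p i *m pinvmx A) f = 0.
Proof.
move=> freeA Tf i /Tf[u pE fu0].
have pA : p i = (p i *m pinvmx A) *m A by rewrite mulmxKpV // pE submxMl.
split=> //; suff <- : u = p i *m pinvmx A by [].
by apply: (row_free_inj freeA); rewrite -pE -pA.
Qed.

Lemma linked_of_rk (A : 'M[K]_(3, N.+1)) (T : {set 'I_n}) :
    (forall i, i \in T -> p i = (p i *m pinvmx A) *m A) ->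
  (rk (fun i => p i *m pinvmx A) T m < #|T|)%N -> linked m P T.
Proof.
move=> pA /rk_lt_card[c [dc cT c0]]; apply/(linked_dep iota P_neq0).
exists c; split=> //; apply: (dep_pullback (A := A)) dc => i ic.
by apply: pA; apply: (subsetP cT).
Qed.

(** Multiples of the conic have codimension [2 * m + 1] among the forms of degree [m] on the plane,
    which bounds the number of independent conditions. *)
Lemma linked_of_conic (T : {set 'I_n}) :
  #|T| = (2 * m + 2)%N -> on_conic iota P T -> linked m P T.
Proof.
move=> cardT [A [f [freeA [fN0 hf] Tf]]].
have coord := plane_coordinates freeA Tf.
apply: (@linked_of_rk A) => [i /coord[]//|].
have := rk_le_mul (u := fun i => p i *m pinvmx A) (T := T) (m - 2) fN0 hf.
rewrite subnK // cardT => /(_ (fun i iT => (coord i iT).2)).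
have := dim3E m; have := dim3E (m - 2); rewrite subnK //.
by move: m_ge2; clear; nia.
Qed.

(** If the [3 * m] conditions were independent, every form of degree [m] through [T] would be a
    multiple of [f]. Then [f] would divide [g], and any irreducible factor of [f] would be a common
    component. *)
Lemma linked_of_intersection (T : {set 'I_n}) : (3 <= m)%N ->
  #|T| = (3 * m)%N -> on_curve_intersection iota P 3 m T -> linked m P T.
Proof.
move=> m_ge3 cardT [A [f [g [freeA [fN0 hf] [gN0 hg] coprime Tfg]]]].
have coordf := plane_coordinates freeA (fun i iT => (Tfg i iT).1).
have coordg := plane_coordinates freeA (fun i iT => (Tfg i iT).2).
apply: (@linked_of_rk A) => [i /coordf[]//|].
set u := fun i => _; rewrite -(subnK m_ge3) in hg *.
have : ~ ('C(m - 3 + 3 + 2, m - 3 + 3) <=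
          rk u T (m - 3 + 3) + 'C(m - 3 + 2, m - 3))%N.
  move=> dim; apply: coprime.
  have [||h hh gE] := vanishing_multiple fN0 hf _ hg _ dim.
  - by move=> i /coordf[].
  - by move=> i /coordg[].
  have [h0 irr [q fE]] := irreducible_factor fN0 (homog_nonunit fN0 hf).
  exists h0; split=> //; first by exists q.
  by exists (q * h); rewrite gE fE; ring.
move/negP; rewrite -ltnNge subnK // cardT.
by have := dim3E m; have := dim3E (m - 3); move: m_ge3; clear; nia.
Qed.

(** A line over [K] through two distinct points rational over [k] is spanned by them, hence is
    defined over [k]. *)
Lemma collinear_descent (S : {set 'I_n}) (L : 'M[K]_(2, N.+1)) :
  (m + 2 <= #|on_line p L S|)%N -> some_subset (m + 2) (collinear P).
Proof.
case/subset_of_card=> T TL cardT; exists T => //.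
have TP i : i \in T -> (p i <= L)%MS.
  by move/(subsetP TL); rewrite inE => /andP[].
have /card_gt0P[i iT] : (0 < #|T|)%N by rewrite cardT addn2.
have /card_gt0P[j] : (0 < #|T :\ i|)%N.
  by move: cardT; rewrite (cardsD1 i) iT; clear; lia.
rewrite in_setD1 eq_sym => /andP[iNj jT].
exists (col_mx (P i) (P j)) => [|l lT].
  rewrite /row_free eqn_leq rank_leq_row.
  exact: (rank_two_points (fun i _ => P_neq0 i) (P_inj (S := T)) iT jT iNj).
have := submx_trans (TP l lT) (line_unique (p_neq0 (S := T)) (p_inj (S := T))
  iT jT iNj (TP _ iT) (TP _ jT)).
by rewrite -map_col_mx map_submx.
Qed.

Lemma linked_card_ge (S : {set 'I_n}) : linked m P S -> (m + 2 <= #|S|)%N.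
Proof.
move=> /(linked_dep iota P_neq0)[c [dc cS c0]].
apply: leq_trans (subset_leq_card cS).
exact: (card_supp_dep (p_neq0 (S := S)) (p_inj (S := S)) dc).
Qed.

Lemma linked_noncollinear_card_ge (S : {set 'I_n}) : linked m P S ->
  ~ some_subset (m + 2) (collinear P) -> (2 * m + 2 <= #|S|)%N.
Proof.
move=> /(linked_dep iota P_neq0)[c [dc cS c0]] noX1.
rewrite addn2 -addn1 ltnNge; apply/negP=> small; apply: noX1.
have c_le := leq_trans (subset_leq_card cS) small.
have [L LP] := dep_collinear (p_neq0 (S := S)) (p_inj (S := S)) dc cS c_le.
apply: (@collinear_descent S L).
apply: leq_trans (card_supp_dep (p_neq0 (S := S)) (p_inj (S := S)) dc cS c0) _.
apply: subset_leq_card; apply/subsetP=> i ic.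
by rewrite inE (subsetP cS) //= LP.
Qed.

Lemma minimal_linked (S : {set 'I_n}) : linked m P S ->
    (forall S', linked m P S' -> (#|S| <= #|S'|)%N) -> (#|S| <= 3 * m)%N ->
  [\/ some_subset (m + 2) (collinear P),
      some_subset (2 * m + 2) (on_conic iota P) |
      #|S| = (3 * m)%N /\ on_curve_intersection iota P 3 m S].
Proof.
move=> /(linked_dep iota P_neq0)[c [dc cS c0]] min_S S_le.
have min_dep c' : dep p m c' -> (0 < #|supp c'|)%N -> (#|S| <= #|supp c'|)%N.
  by move=> dc' c'0; apply: min_S; apply/(linked_dep iota P_neq0); exists c'.
have supp_c : supp c = S by apply/eqP; rewrite eqEcard cS min_dep.
have [?|noX1] := classic (some_subset (m + 2) (collinear P)); first exact: Or31.
have [?|noX2] := classic (some_subset (2 * m + 2) (on_conic iota P));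
  first exact: Or32.
have lineS (L : 'M[K]_(2, N.+1)) : (#|on_line p L S| <= m + 1)%N.
  by rewrite leqNgt; apply/negP=> big;
    apply/noX1/(collinear_descent (L := L) (S := S)); move: big; clear; lia.
have S_ge : (m + 2 <= #|S|)%N.
  by rewrite -supp_c; apply: (card_supp_dep (p_neq0 (S := S)) (p_inj (S := S))
    dc).
have c_le : (#|supp c| <= 3 * m)%N by rewrite supp_c.
have [[A AP]|[L big]] := dep_coplanar (p_neq0 (S := S)) (p_inj (S := S)) dc cS
  c_le; last first.
  by have := lineS L; rewrite -supp_c; move: big; clear; lia.
rewrite supp_c in AP.
(* If [A] had rank at most 2, all of [S], at least [m + 2] points, would lie on a line. *)
have freeA : row_free A.
  rewrite /row_free eqn_leq rank_leq_row ltnNge;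
    apply/negP=> /thin_matrix[L AL].
  have := lineS L; have -> : on_line p L S = S.
    apply/setP=> i; rewrite inE; case: (boolP (i \in S)) => //= iS.
    exact: submx_trans (AP i iS) AL.
  by move: S_ge; clear; lia.
pose u i := p i *m pinvmx A.
have uA i : i \in S -> p i = u i *m A by move=> iS; rewrite mulmxKpV ?AP.
have u_neq0 i : i \in S -> u i != 0.
  move=> iS; apply: contraNneq (p_neq0 iS) => u0.
  by rewrite uA // u0 mul0mx.
have u_inj : {in S &, forall i j, (u i <= u j)%MS -> i = j}.
  move=> i j iS jS /(submxMr A); rewrite -!uA //; exact: p_inj iS jS.
have dep_up c' : dep p m c' -> dep u m c'.
  exact: (dep_pullback (A := pinvmx A)).
have dep_pu c' : supp c' \subset S -> dep u m c' -> dep p m c'.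
  by move=> c'S; apply: (dep_pullback (A := A)) => i ic; apply: uA;
    apply: (subsetP c'S).
have no_line (l : {mpoly K[3]}) : l != 0 -> l \is 1.-homog ->
    (#|zeros u S l| <= m + 1)%N.
  move=> lN0 /homog1_linform[a lE]; rewrite {}lE in lN0 *.
  (* The kernel of a nonzero linear form on the plane has dimension at most 2; its image under [A]
     is the line in the ambient space. *)
  have [|L LP] := @thin_matrix _ _ _ 2 (kermx a).
    rewrite mxrank_ker leq_subLR; have : (0 < \rank a)%N; last by clear; lia.
    rewrite lt0n mxrank_eq0; apply: contraNneq lN0 => ->.
    by rewrite /linform big1 // => j _; rewrite mxE scale0r.
  apply: leq_trans (lineS (L *m A)); apply: subset_leq_card.
  apply/subsetP=> i; rewrite !inE => /andP[iS];
    rewrite iS evalv_linform /= => /eqP a0.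
  rewrite uA // submxMr // (submx_trans _ LP) //; apply/sub_kermxP.
  by apply/rowP=> j; rewrite !ord1 a0 mxE.
have no_conic (q : {mpoly K[3]}) : q != 0 -> q \is 2.-homog ->
    (#|zeros u S q| <= 2 * m + 1)%N.
  move=> qN0 hq; rewrite leqNgt; apply/negP=> big; apply: noX2.
  have [|T Tq cardT] := @subset_of_card _ (zeros u S q) (2 * m + 2).
    by move: big; clear; lia.
  exists T => //; exists A, q; split=> // i /(subsetP Tq).
  by rewrite inE => /andP[iS /eqP q0]; exists (u i); first exact: uA.
have S_gt0 : (0 < #|S|)%N by rewrite -supp_c.
have min_u c' : dep u m c' -> supp c' \subset S -> (0 < #|supp c'|)%N ->
    (#|S| <= #|supp c'|)%N.
  by move=> dc' c'S; apply: min_dep; apply: dep_pu.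
have [cardS [f [g [hf hg coprime fg0]]]] := circuit_complete_intersection
  u_neq0 u_inj m_ge2 (dep_up _ dc) supp_c S_gt0 min_u S_le no_line no_conic.
apply: Or33; split=> //; exists A, f, g; split=> // i iS.
by have [f0 g0] := fg0 i iS; split; exists (u i) => //; apply: uA.
Qed.

End Points.

Local Close Scope ring_scope.

Theorem theorem3p8 (k : fieldType) (K : closedFieldType)
    (iota : {rmorphism k -> K}) (hK : algebraic_closure iota)
    (N n : nat) (P : 'I_n -> 'rV[k]_N.+1) (hP : distinct_points P)
    (m : nat) (hm : (2 <= m)) :
  [/\ min_linked m P = Some (m + 2) <->
        some_subset (m + 2) (collinear P),
      min_linked m P = Some (2 * m + 2) <->
        ~ some_subset (m + 2) (collinear P) /\
        some_subset (2 * m + 2) (on_conic iota P),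
      (* 3m <> 2m+2 only excludes m = 2, where the value 3m = 2m+2 belongs to
         the preceding case. *)
      min_linked m P = Some (3 * m) /\ (3 * m) <> (2 * m + 2) <->
        [/\ ~ some_subset (m + 2) (collinear P),
            ~ some_subset (2 * m + 2) (on_conic iota P) &
            some_subset (3 * m) (on_curve_intersection iota P 3 m)] &
      lt_inf (3 * m) (min_linked m P) <->
        [/\ ~ some_subset (m + 2) (collinear P),
            ~ some_subset (2 * m + 2) (on_conic iota P) &
            ~ some_subset (3 * m) (on_curve_intersection iota P 3 m)]].
Proof.
set X1 := some_subset (m + 2) _; set X2 := some_subset (2 * m + 2) _.
set X3 := some_subset (3 * m) _; have minP := min_linkedP m P.
have boundedP S s : linked m P S -> #|S| = s ->
    exists2 t, min_linked m P = Some t & t <= s.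
  move=> linkedS <-; case: (min_linked m P) minP => [t [_ min_t]|/(_ S)//].
  by exists t => //; apply: min_t.
have X1b : X1 -> exists2 t, min_linked m P = Some t & t <= m + 2.
  case=> T cardT colT.
  exact: boundedP (linked_of_collinear hP cardT colT) cardT.
have X2b : X2 -> exists2 t, min_linked m P = Some t & t <= 2 * m + 2.
  case=> T cardT conT.
  exact: boundedP (linked_of_conic hP hm cardT conT) cardT.
(* For [m = 2] the curve [g] is itself a conic, and [3 * m = 2 * m + 2]. *)
have X3_2 : m = 2 -> X3 -> X2.
  move=> m2 [T cardT [A [f [g [freeA _ hg _ Tfg]]]]]; exists T.
    by rewrite cardT m2.
  exists A, g; split=> //; first by rewrite m2 in hg.
  by move=> i /Tfg[].
have X3b : X3 -> exists2 t, min_linked m P = Some t & t <= 3 * m.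
  have [m2|m_ge3] : m = 2 \/ 3 <= m by lia.
    by move=> /(X3_2 m2)/X2b; rewrite m2.
  case=> T cardT intT.
  exact: boundedP (linked_of_intersection hP m_ge3 cardT intT) cardT.
have low t : min_linked m P = Some t ->
    [/\ m + 2 <= t, ~ X1 -> 2 * m + 2 <= t &
        t <= 3 * m -> [\/ X1, X2 | t = 3 * m /\ X3]].
  move=> Mt; move: minP; rewrite Mt => -[[S linkedS <-] minS].
  split; first exact: (linked_card_ge iota hP).
    exact: (linked_noncollinear_card_ge iota hP).
  move=> le_t; have [||[cardS intS]] := minimal_linked iota hP hm linkedS minS
    le_t.
  - exact: Or31.
  - exact: Or32.
  - by apply: Or33; split=> //; exists S.
have X1E : X1 -> min_linked m P = Some (m + 2).
  case/X1b=> t Mt le_t; rewrite Mt; congr Some.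
  by have [ge_t _ _] := low _ Mt; apply/eqP; rewrite eqn_leq le_t.
have X2E : ~ X1 -> X2 -> min_linked m P = Some (2 * m + 2).
  move=> no1 /X2b[t Mt le_t]; rewrite Mt; congr Some.
  by have [_ /(_ no1) ge_t _] := low _ Mt; apply/eqP; rewrite eqn_leq le_t.
have no_1 t : min_linked m P = Some t -> m + 2 < t -> ~ X1.
  by move=> Mt lt_t /X1E; rewrite Mt => -[tE]; rewrite tE ltnn in lt_t.
split.
- split=> // Mt; have [_ ge_t _] := low _ Mt.
  apply: NNPP => no1; have := ge_t no1; move: hm; clear; lia.
- split=> [Mt|[no1 x2]]; last exact: X2E.
  have no1 : ~ X1 by apply: (no_1 _ Mt); move: hm; clear; lia.
  split=> //; have le_3m : 2 * m + 2 <= 3 * m by move: hm; clear; lia.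
  have [_ _ /(_ le_3m)[//|//|[m2 x3]]] := low _ Mt.
  by apply: X3_2 x3; move: m2; clear; lia.
- split=> [[Mt m2]|[no1 no2 x3]].
    have no1 : ~ X1 by apply: (no_1 _ Mt); move: hm; clear; lia.
    have no2 : ~ X2 by move=> /(X2E no1); rewrite Mt => -[].
    by split=> //; have [_ _ /(_ (leqnn _))[]] := low _ Mt => // -[].
  have [t Mt le_t] := X3b x3; have [_ _ /(_ le_t)[//|//|[tE _]]] := low _ Mt.
  rewrite Mt tE; split=> // m2; apply: no2; apply: X3_2 x3.
  by move: m2; clear; lia.
- split=> [inf|[no1 no2 no3]].
    have not_le s : s <= 3 * m -> ~ exists2 t, min_linked m P = Some t & t <= s.
      move=> s_le [t Mt t_le]; move: inf; rewrite Mt /= ltnNge.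
      by rewrite (leq_trans t_le s_le).
    split=> [/X1b|/X2b|/X3b]; apply: not_le; by move: hm; clear; lia.
  case Mt: (min_linked m P) => [t|//] /=; rewrite ltnNge; apply/negP=> le_t.
  by have [_ _ /(_ le_t)[//|//|[_]]] := low _ Mt.
Qed.
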